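(* Let $p\in\mathbb R_{\ge 1}$ and $k\in\mathbb N$ with $k\ge 1$. Let $\phi\in(1-\frac1p,1]$ and let $\omega$ be a control on $J$. Let $H\in\mathscr H^{(k,p)}_{\phi,\omega}(V)$ and let $X\in\Omega^{(k,p)}_\omega(V)$. Then both maps $X\oplus H$ and $X\otimes H$ belong to $\Omega^{\mathrm{am},(k,p)}_{\phi+\frac1p,\omega}(V)$, i.e. each of them is $(\phi+\frac1p)$-almost multiplicative of degree $k$ and of finite $p$-variation, controlled by $\omega$ with some constant (constants $K\ge 0$ and $\tilde K\ge0$ respectively). Moreover, setting $X\boxplus H:=\mathscr S^k(X\oplus H)\in\Omega^{(k,p)}_\omega(V)$, one has $\mathscr S^k(X\otimes H)=X\boxplus H$.
   Context: Setting. $J=[S,T]$ is a fixed compact interval and $\triangle_J=\{(s,t)\in J^2: s\le t\}$. $V$ is a Banach space; $V^{\otimes n}$ ($V^{\otimes 0}=\mathbb R$) denotes its completed tensor powers with admissible norms: permutations in the symmetric group $S_n$ act by isometries on $V^{\otimes n}$, and $\|v\otimes w\|\le\|v\|\|w\|$ for $v\in V^{\otimes n}$, $w\in V^{\otimes m}$. $T^{(k)}(V)=\bigoplus_{i=0}^kV^{\otimes i}$ is the truncated tensor algebra with product $(a\otimes b)^i=\sum_{j=0}^i a^j\otimes b^{i-j}$; $a^i$ denotes the level-$i$ component. A control on $J$ is a continuous $\omega:\triangle_J\to[0,\infty)$ with $\omega(t,t)=0$ and $\omega(s,u)+\omega(u,t)\le\omega(s,t)$ for all $s\le u\le t$. Put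 $x!:=\Gamma(x+1)$ and $\beta(p)=p\bigl(1+\sum_{r=3}^\infty(\frac{2}{r-2})^{(\lfloor p\rfloor+1)/p}\bigr)$. A map $X:\triangle_J\to T^{(k)}(V)$ has finite $p$-variation controlled by $\omega$ with constant $K\ge0$ if $\|X^i_{s,t}\|\le K\,\omega(s,t)^{i/p}/(\beta(p)(i/p)!)$ for all $i=1,\dots,k$ and $(s,t)\in\triangle_J$. A multiplicative functional of degree $k$ is a continuous $X:\triangle_J\to T^{(k)}(V)$ with $X^0\equiv1$ and $X_{s,u}\otimes X_{u,t}=X_{s,t}$ for $s\le u\le t$. $\Omega^{(k,p)}_\omega(V)$ is the set of those having finite $p$-variation controlled by $\omega$ with some constant; $\Omega^{(k,p)}(V)$ is the union over all controls $\omega$. For $\theta>1$, $\Omega^{\mathrm{am},(k,p)}_{\theta,\omega}(V)$ is the set of maps $X=(1,X^1,\dots,X^k):\triangle_J\to T^{(k)}(V)$ for which there is $K\ge0$ such that $X$ has finite $p$-variation controlled by $\omega$ with constant $K$ and $X$ is $\theta$-almost multiplicative of degree $k$ controlled by $\omega$ with constant $K$: $\|(X_{s,u}\otimes X_{u,t}-X_{s,t})^i\|\le K\omega(s,t)^\theta$ for $s\le u\le t$, $i=1,\dots,k$. Sewing map (Lyons' rough sewing lemma, known): for $X\in\Omega^{\mathrm{am},(k,p)}_{\theta,\omega}(V)$ there is a unique multiplicative functional $\bar X$ of degree $k$ with finite $p$-variation such that for some $C$, $\|\bar X^i_{s,t}-X^i_{s,t}\|\le C\omega(s,t)^\theta$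 for all $(s,t)\in\triangle_J$, $i=1,\dots,k$; moreover $\bar X\in\Omega^{(k,p)}_\omega(V)$. It does not depend on the choice of $(p,\theta,\omega)$ witnessing almost multiplicativity and finite $p$-variation, and is denoted $\mathscr S^k(X)$. For $\phi\in(1-\frac1p,1]$, $\mathscr H^{(k,p)}_{\phi,\omega}(V)$ is the set of $H\in\Omega^{(k,p)}_\omega(V)$ for which there is $K_H\ge0$ with $\|H^j_{s,t}\|\le K_H\,\omega(s,t)^\phi$ for all $j=1,\dots,k$, $(s,t)\in\triangle_J$. For maps $X,H:\triangle_J\to T^{(k)}(V)$ with $X^0=H^0=1$: $(X\otimes H)_{s,t}:=X_{s,t}\otimes H_{s,t}$ and $(X\oplus H)_{s,t}:=(1,X^1_{s,t}+H^1_{s,t},\dots,X^k_{s,t}+H^k_{s,t})$. *)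

(* Defs.v *)
From HB Require Import structures.
From mathcomp Require Import all_boot all_order all_algebra fingroup perm.
From mathcomp Require Import all_classical all_reals all_analysis.

Set Implicit Arguments.
Unset Strict Implicit.
Unset Printing Implicit Defensive.

Import Order.TTheory GRing.Theory Num.Theory.
Import numFieldNormedType.Exports.

Local Open Scope classical_set_scope.
Local Open Scope ring_scope.

Definition upd n (V : Type) (v : 'I_n -> V) (i : 'I_n) (x : V) : 'I_n -> V :=
  fun j => if j == i then x else v j.

Definition multilinear (R : realType) n (V W : lmodType R)
    (f : ('I_n -> V) -> W) : Prop :=
  forall (v : 'I_n -> V) (i : 'I_n), linear (fun x => f (upd v i x)).

Definition concat (V : Type) m n (u : 'I_m -> V) (w : 'I_n -> V) :
    'I_(m + n) -> V :=
  fun i => match fintype.split i with inl j => u j | inr j => w j end.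

(* The completed tensor powers of [V] for a system of admissible norms, known
   up to isometric isomorphism: [tp n] is a Banach space, [tp_pure v] is the
   elementary tensor v_0 ⊗ ... ⊗ v_(n-1), and [tp_mul] is the product
   V^{⊗m} x V^{⊗n} -> V^{⊗(m+n)}.  By [tp_pure_multilinear] and
   [tp_pure_universal] the span of the elementary tensors is the algebraic
   n-th tensor power of [V] (every linear relation between elementary tensors
   is a consequence of multilinearity), and by [tp_pure_dense] the space [tp n]
   is its completion.  [tp_norm0] and [tp_norm1] identify V^{⊗0} with the
   scalars (the unit being the empty tensor) and V^{⊗1} with V, isometrically.
   The values on elementary tensors and the norm bound determine [tp_mul], so
   that associativity and unitality need not be required. *)
Record tensorPowers (R : realType) (V : completeNormedModType R) := TensorPowers {
  tp :> nat -> completeNormedModType R ;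
  tp_pure : forall n, ('I_n -> V) -> tp n ;
  tp_mul : forall m n, {bilinear tp m -> tp n -> tp (m + n)%N} ;
  tp_pure_multilinear : forall n, multilinear (@tp_pure n) ;
  tp_pure_universal : forall n (W : lmodType R) (f : ('I_n -> V) -> W),
    multilinear f ->
    forall (N : nat) (c : 'I_N -> R) (v : 'I_N -> 'I_n -> V),
      \sum_(l < N) c l *: tp_pure (v l) = 0 -> \sum_(l < N) c l *: f (v l) = 0 ;
  tp_pure_dense : forall n,
    dense [set x : tp n | exists (N : nat) (c : 'I_N -> R) (v : 'I_N -> 'I_n -> V),
      x = \sum_(l < N) c l *: tp_pure (v l)] ;
  tp_norm0 : forall v : 'I_0 -> V, `|tp_pure v| = 1 ;
  tp_norm1 : forall v : 'I_1 -> V, `|tp_pure v| = `|v ord0| ;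
  tp_mul_pure : forall m n (u : 'I_m -> V) (w : 'I_n -> V),
    tp_mul m n (tp_pure u) (tp_pure w) = tp_pure (concat u w) ;
  tp_norm_mul : forall m n (x : tp m) (y : tp n), `|tp_mul m n x y| <= `|x| * `|y| ;
  tp_perm : forall n (s : 'S_n), exists g : {linear tp n -> tp n},
    (forall x, `|g x| = `|x|) /\
    (forall v : 'I_n -> V, g (tp_pure v) = tp_pure (fun i => v (s i)))
}.

Section TruncatedTensorAlgebra.
Context (R : realType) (V : completeNormedModType R) (E : tensorPowers V).
Variable k : nat.

Definition truncTensor := prod_topology (fun i : 'I_k.+1 => E i).

Definition tone : truncTensor := fun i =>
  match nat_of_ord i as n return E n with
  | 0 => tp_pure E (fun=> 0)
  | _.+1 => 0
  end.

Definition tcast m n (e : m = n) (x : E m) : E n := ecast l (E l) e x.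

(* The index j ranges over 0, ..., i, and the cast is along j + (i - j) = i. *)
Definition tmul (a b : truncTensor) : truncTensor := fun i =>
  \sum_(j < i.+1)
    tcast (subnKC (leq_ord j))
      (tp_mul E j (i - j)
        (a (widen_ord (ltn_ord i) j))
        (b (Ordinal (leq_ltn_trans (leq_subr j i) (ltn_ord i))))).

Definition toplus (a b : truncTensor) : truncTensor := fun i =>
  if i == ord0 then tone i else a i + b i.

End TruncatedTensorAlgebra.

Definition simplex (R : realType) (S T : R) : set (R * R) :=
  [set z | [/\ S <= z.1, z.1 <= z.2 & z.2 <= T]].

(* [splits c a b] : a = (s, u), b = (u, t) and c = (s, t). *)
Definition splits (R : realType) (S T : R) (c a b : simplex S T) : Prop :=
  [/\ (set_val a).1 = (set_val c).1, (set_val a).2 = (set_val b).1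
    & (set_val b).2 = (set_val c).2].

Record control (R : realType) (S T : R) (w : simplex S T -> R) : Prop := Control {
  control_continuous : continuous w ;
  control_ge0 : forall a, 0 <= w a ;
  control_diag : forall a : simplex S T, (set_val a).1 = (set_val a).2 -> w a = 0 ;
  control_superadd : forall a b c : simplex S T, splits c a b -> w a + w b <= w c
}.

Definition Gamma (R : realType) (x : R) : R :=
  \int[lebesgue_measure]_(t in `]0, +oo[) (t `^ (x - 1) * expR (- t)).

Definition rfact (R : realType) (x : R) : R := Gamma (x + 1).

Definition lyons_beta (R : realType) (p : R) : R :=
  p * (1 + limn (fun n => \sum_(3 <= r < n)
                   (2 / (r%:R - 2)) `^ (((Num.floor p)%:~R + 1) / p))).

Section Functionals.
Context (R : realType) (V : completeNormedModType R) (E : tensorPowers V).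
Variables (S T : R) (k : nat).

Local Notation tpath := (simplex S T -> truncTensor E k).
Implicit Types (X Y H : tpath) (p theta phi K : R) (w : simplex S T -> R).

Definition finite_pvar_with p w K X : Prop :=
  forall (i : 'I_k.+1) (a : simplex S T), (0 < i)%N ->
    `|X a i| <= K * w a `^ (i%:R / p) / (lyons_beta p * rfact (i%:R / p)).

Definition almost_mult_with theta w K X : Prop :=
  forall (i : 'I_k.+1) (a b c : simplex S T), (0 < i)%N -> splits c a b ->
    `|tmul (X a) (X b) i - X c i| <= K * w c `^ theta.

Record mult_functional X : Prop := MultFunctional {
  mult_continuous : continuous X ;
  mult_level0 : forall a, X a ord0 = tone E ord0 ;
  mult_chen : forall a b c : simplex S T, splits c a b -> tmul (X a) (X b) = X c
}.

Definition Omega p w : set tpath :=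
  [set X : tpath | mult_functional X /\ exists2 K, 0 <= K & finite_pvar_with p w K X].

Definition Omega_any p : set tpath :=
  [set X : tpath | exists2 w, control w & Omega p w X].

Definition Omega_am p theta w : set tpath :=
  [set X : tpath | (forall a, X a ord0 = tone E ord0) /\
     exists K, [/\ 0 <= K, finite_pvar_with p w K X & almost_mult_with theta w K X]].

Definition Hspace p phi w : set tpath :=
  [set H : tpath | Omega p w H /\ exists2 K, 0 <= K &
     forall (j : 'I_k.+1) (a : simplex S T), (0 < j)%N -> `|H a j| <= K * w a `^ phi].

Definition sewn p theta w X : set tpath :=
  [set Y : tpath | Omega_any p Y /\ exists C : R, forall (i : 'I_k.+1) (a : simplex S T),
     (0 < i)%N -> `|Y a i - X a i| <= C * w a `^ theta].

(* The sewing of [X] does not depend on the data (p, theta, w) witnessing that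
   [X] is almost multiplicative, which are therefore quantified existentially.
   The default value, taken when there is no sewing, vanishes on level 0 and so
   is not a multiplicative functional. *)
Definition sewing X : tpath :=
  xget (fun _ _ => 0)
    [set Y : tpath | exists p theta w,
       [/\ 1 <= p, 1 < theta, control w, Omega_am p theta w X & sewn p theta w X Y]].

Definition path_tensor X H : tpath := fun a => tmul (X a) (H a).

Definition path_oplus X H : tpath := fun a => toplus (X a) (H a).

Definition path_boxplus X H : tpath := sewing (path_oplus X H).

End Functionals.

(* Main.v *)
Require Import Defs.
From HB Require Import structures.
From mathcomp Require Import all_boot all_order all_algebra fingroup perm.
From mathcomp Require Import all_classical all_reals all_analysis.
From mathcomp Require Import measurable_realfun lra.
Import Order.TTheory GRing.Theory Num.Theory.
Import numFieldNormedType.Exports.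
Local Open Scope classical_set_scope.
Local Open Scope ring_scope.

(** Chen's relations for [X] and [H] cancel in the defect of [X (+) H], and leave
    products of one component of [X], which is O(w^(1/p)), by one component of
    [H], which is O(w^phi): hence almost multiplicativity with exponent
    [theta = phi + 1/p > 1] ([path_oplus_almost_mult]). The difference between
    [X (x) H] and [X (+) H] consists of products of the same kind, so that the two
    maps agree up to O(w^theta) ([path_tensor_close]). Almost multiplicativity is
    stable under such a perturbation ([almost_mult_close]), and two maps that
    agree up to O(w^theta) have the same sewing, as soon as sewings exist and are
    unique.

    Uniqueness ([sewing_unique]): by induction on the level, the difference of two
    sewings is additive on the current level and O(w^theta). A control can be
    halved at some point of any interval ([control_halve]); each halving improves
    the constant of an additive function by [2^(1-theta) < 1], which therefore is 0
    ([subadditive_bound]).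

    Existence ([rough_sewing]): again level by level. If Chen's relation holds
    below level [i], associativity of the product makes the defect of Chen's
    relation on level [i] a 2-cocycle ([sew_level]). A 2-cocycle of order
    [theta > 1] is a coboundary ([additive_sewing]): its sums along subdivisions
    are bounded regardless of the number of points ([defect_bound]) and converge
    along successive halvings. The result inherits its p-variation from the
    original on the levels [i <= theta p], and on higher levels from Chen's
    relation ([sewn_pvar]); its continuity also follows from Chen's relation
    ([chen_continuous]).

    Associativity and unitality of the tensor product hold on elementary tensors
    and extend by density ([eq_linear_pure]). The normalizing constants in the
    definition of finite p-variation are positive ([rfact_gt0], [lyons_beta_gt0]),
    so that they can be absorbed in the constant ([pvarP]). *)

Set Implicit Arguments.
Unset Strict Implicit.
Unset Printing Implicit Defensive.

(** * Algebra of the truncated tensor product *)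

Local Notation tcast := Defs.tcast.

Section GradedProduct.
Context {R : realType} {V : completeNormedModType R} (E : tensorPowers V).

Lemma norm_tcast m n (e : m = n) (x : E m) : `|tcast e x| = `|x|.
Proof. by case: _ / e. Qed.

Lemma tcast_linear m n (e : m = n) : linear (@tcast R V E m n e).
Proof. by case: _ / e. Qed.

Lemma tcast_pure m n (e : m = n) (v : 'I_m -> V) :
  tcast e (tp_pure E v) = tp_pure E (v \o cast_ord (esym e)).
Proof.
case: _ / e; congr tp_pure; apply/funext => i /=; congr v; exact: val_inj.
Qed.

(** Linearity extends the equality to the span of the elementary tensors, which
    is dense, and boundedness extends it to the whole space. *)
Lemma eq_linear_pure m (W : normedModType R) (f g : E m -> W) (C : R) :
  linear f -> linear g -> (forall x, `|f x| <= C * `|x|) ->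
  (forall x, `|g x| <= C * `|x|) ->
  (forall u, f (tp_pure E u) = g (tp_pure E u)) -> f =1 g.
Proof.
move=> lf lg bf bg fg x.
pose h y := f y - g y.
have hD y z : h (y + z) = h y + h z.
  have := lf 1 y z; have := lg 1 y z; rewrite !scale1r /h => -> ->.
  by rewrite opprD addrACA.
have h0 : h 0 = 0 by apply: (@addrI _ (h 0)); rewrite -hD !addr0.
have hZ a y : h (a *: y) = a *: h y.
  have f0 : f 0 = 0.
    by have := lf 1 0 0; rewrite !scale1r addr0 -[LHS]addr0 => /addrI <-.
  have g0 : g 0 = 0.
    by have := lg 1 0 0; rewrite !scale1r addr0 -[LHS]addr0 => /addrI <-.
  by have := lf a y 0; have := lg a y 0; rewrite /h !addr0 f0 g0 !addr0 scalerBr => -> ->.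
have hsum N (c : 'I_N -> R) v : h (\sum_(l < N) c l *: tp_pure E (v l)) = 0.
  rewrite (big_morph h hD h0) big1// => l _.
  by rewrite hZ /h fg subrr scaler0.
have hb y : `|h y| <= (C + C) * `|y|.
  by rewrite mulrDl (le_trans (ler_normB _ _))// lerD.
apply/eqP; rewrite -subr_eq0 -normr_le0; apply/ler_addgt0Pl => e e0.
rewrite addr0.
pose D := C + C; have [D0|D0] := leP D 0.
  by rewrite (le_trans (hb x))// (le_trans _ (ltW e0))// mulr_le0_ge0.
have [y [xy [N [c [v yE]]]]] :
    (ball x (e / D) `&` [set x : E m | exists (N : nat) (c : 'I_N -> R)
      (v : 'I_N -> 'I_m -> V), x = \sum_(l < N) c l *: tp_pure E (v l)]) !=set0.
  apply: (@tp_pure_dense R V E m); last exact: ball_open.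
  by exists x; apply: ballxx; rewrite divr_gt0.
have -> : f x - g x = h (x - y).
  rewrite hD -[f x - g x]/(h x) yE -scaleN1r hZ hsum.
  by rewrite scaler0 addr0.
rewrite (le_trans (hb _))// mulrC -ler_pdivlMr//.
by move: xy; rewrite -ball_normE => /ltW.
Qed.

(** Extending the product by zero to all target degrees gives sums of products
    over all pairs of degrees, with no cast in sight. *)
Definition gmul m n i (x : E m) (y : E n) : E i :=
  match @eqP _ (m + n)%N i with
  | ReflectT e => tcast e (tp_mul E m n x y)
  | ReflectF _ => 0
  end.

Lemma gmulE m n i (e : (m + n)%N = i) (x : E m) (y : E n) :
  gmul i x y = tcast e (tp_mul E m n x y).
Proof. by rewrite /gmul; case: eqP => // e'; rewrite (eq_irrelevance e e'). Qed.

Lemma gmul_neq m n i (x : E m) (y : E n) : (m + n)%N != i -> gmul i x y = 0.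
Proof. by rewrite /gmul; case: eqP. Qed.

Lemma gmul_linearl m n i (y : E n) : linear (fun x : E m => gmul i x y).
Proof.
move=> a u v; rewrite /gmul; case: eqP => [e|_]; last by rewrite scaler0 addr0.
by rewrite linearPl tcast_linear.
Qed.

Lemma gmul_linearr m n i (x : E m) : linear (fun y : E n => gmul i x y).
Proof.
move=> a u v; rewrite /gmul; case: eqP => [e|_]; last by rewrite scaler0 addr0.
by rewrite linearPr tcast_linear.
Qed.

Lemma gmulDl m n i (x x' : E m) (y : E n) :
  gmul i (x + x') y = gmul i x y + gmul i x' y.
Proof. by have := @gmul_linearl m n i y 1 x x'; rewrite !scale1r. Qed.

Lemma gmulDr m n i (x : E m) (y y' : E n) :
  gmul i x (y + y') = gmul i x y + gmul i x y'.
Proof. by have := @gmul_linearr m n i x 1 y y'; rewrite !scale1r. Qed.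

Lemma gmul0l m n i (y : E n) : gmul i (0 : E m) y = 0.
Proof. by apply: (@addrI _ (gmul i (0 : E m) y)); rewrite -gmulDl !addr0. Qed.

Lemma gmul0r m n i (x : E m) : gmul i x (0 : E n) = 0.
Proof. by apply: (@addrI _ (gmul i x (0 : E n))); rewrite -gmulDr !addr0. Qed.

Lemma gmulBl m n i (x x' : E m) (y : E n) :
  gmul i (x - x') y = gmul i x y - gmul i x' y.
Proof. by apply: (@addIr _ (gmul i x' y)); rewrite -gmulDl !subrK. Qed.

Lemma gmulBr m n i (x : E m) (y y' : E n) :
  gmul i x (y - y') = gmul i x y - gmul i x y'.
Proof. by apply: (@addIr _ (gmul i x y')); rewrite -gmulDr !subrK. Qed.

Lemma gmul_suml m n i (I : Type) (r : seq I) (F : I -> E m) (y : E n) :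
  gmul i (\sum_(j <- r) F j) y = \sum_(j <- r) gmul i (F j) y.
Proof. by elim/big_rec2: _ => [|j u v _ <-]; rewrite ?gmul0l ?gmulDl. Qed.

Lemma gmul_sumr m n i (I : Type) (r : seq I) (x : E m) (F : I -> E n) :
  gmul i x (\sum_(j <- r) F j) = \sum_(j <- r) gmul i x (F j).
Proof. by elim/big_rec2: _ => [|j u v _ <-]; rewrite ?gmul0r ?gmulDr. Qed.

Lemma norm_gmul m n i (x : E m) (y : E n) : `|gmul i x y| <= `|x| * `|y|.
Proof.
rewrite /gmul; case: eqP => [e|_]; first by rewrite norm_tcast tp_norm_mul.
by rewrite normr0 mulr_ge0.
Qed.

Lemma concatA m n l (u : 'I_m -> V) (v : 'I_n -> V) (w : 'I_l -> V) :
  concat (concat u v) w = concat u (concat v w) \o cast_ord (esym (addnA m n l)).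
Proof.
apply/funext => i /=; rewrite /concat.
have [j ij|j ij] := split_ordP i; last first.
  have -> : cast_ord (esym (addnA m n l)) i = rshift m (rshift n j).
    by apply/val_inj; rewrite ij /= addnA.
  by rewrite !(unsplitK (inr _)).
have [j' jj|j' jj] := split_ordP j.
  have -> : cast_ord (esym (addnA m n l)) i = lshift (n + l) j'.
    by apply/val_inj; rewrite ij jj.
  by rewrite (unsplitK (inl _)).
have -> : cast_ord (esym (addnA m n l)) i = rshift m (lshift l j').
  by apply/val_inj; rewrite ij jj.
by rewrite (unsplitK (inr _)) (unsplitK (inl _)).
Qed.

Lemma gmulA_pure m n l i (u : 'I_m -> V) (v : 'I_n -> V) (w : 'I_l -> V) :
  (m + n + l)%N = i ->
  gmul i (gmul (m + n) (tp_pure E u) (tp_pure E v)) (tp_pure E w) =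
  gmul i (tp_pure E u) (gmul (n + l) (tp_pure E v) (tp_pure E w)).
Proof.
move=> e; have e' : (m + (n + l))%N = i by rewrite addnA.
rewrite (gmulE (erefl (m + n)%N)) (gmulE (erefl (n + l)%N)) (gmulE e) (gmulE e').
rewrite /= !tp_mul_pure !tcast_pure concatA; congr tp_pure.
by apply/funext => j /=; congr concat; apply/val_inj.
Qed.

(** Both sides are trilinear and bounded, so that it is enough to compare them
    on elementary tensors, one variable after the other. *)
Lemma gmulA m n l i (x : E m) (y : E n) (z : E l) : (m + n + l)%N = i ->
  gmul i (gmul (m + n) x y) z = gmul i x (gmul (n + l) y z).
Proof.
move=> e.
have bl (x' : E m) (y' : E n) (z' : E l) :
    `|gmul i (gmul (m + n) x' y') z'| <= `|x'| * `|y'| * `|z'|.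
  by rewrite (le_trans (norm_gmul _ _ _))// ler_wpM2r// norm_gmul.
have br (x' : E m) (y' : E n) (z' : E l) :
    `|gmul i x' (gmul (n + l) y' z')| <= `|x'| * `|y'| * `|z'|.
  by rewrite (le_trans (norm_gmul _ _ _))// -mulrA ler_wpM2l// norm_gmul.
have pure3 (u : 'I_m -> V) (v : 'I_n -> V) :
    (fun z => gmul i (gmul (m + n) (tp_pure E u) (tp_pure E v)) z) =1
    (fun z : E l => gmul i (tp_pure E u) (gmul (n + l) (tp_pure E v) z)).
  apply: (@eq_linear_pure l _ _ _ (`|tp_pure E u| * `|tp_pure E v|)) => //.
  - exact: gmul_linearr.
  - by move=> a z1 z2; rewrite !gmul_linearr.
  - by move=> w; exact: gmulA_pure.
have pure2 (u : 'I_m -> V) : (fun y => gmul i (gmul (m + n) (tp_pure E u) y) z) =1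
    (fun y : E n => gmul i (tp_pure E u) (gmul (n + l) y z)).
  apply: (@eq_linear_pure n _ _ _ (`|tp_pure E u| * `|z|)) => //.
  - by move=> a y1 y2; rewrite gmul_linearr gmul_linearl.
  - by move=> a y1 y2; rewrite gmul_linearl gmul_linearr.
  - by move=> y'; rewrite mulrAC.
  - by move=> y'; rewrite mulrAC.
  - by move=> v; exact: pure3.
apply: (@eq_linear_pure m _ (fun x => gmul i (gmul (m + n) x y) z)
  (fun x => gmul i x (gmul (n + l) y z)) (`|y| * `|z|)).
- by move=> a y1 y2; rewrite !gmul_linearl.
- by move=> a y1 y2; rewrite gmul_linearl.
- by move=> x'; rewrite mulrC mulrA.
- by move=> x'; rewrite mulrC mulrA.
- by move=> v; exact: pure2.
Qed.

Lemma gmul1l n (x : E n) : gmul n (tp_pure E (fun _ : 'I_0 => 0)) x = x.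
Proof.
have norm1 : `|tp_pure E (fun _ : 'I_0 => 0)| = 1 by exact: tp_norm0.
apply: (@eq_linear_pure n _ (gmul n (tp_pure E (fun _ : 'I_0 => 0))) id 1) => //.
- exact: gmul_linearr.
- by move=> y; rewrite (le_trans (norm_gmul _ _ _))// norm1.
- by move=> y; rewrite mul1r.
move=> u; rewrite (gmulE (add0n n)) tp_mul_pure tcast_pure; congr tp_pure.
apply/funext => i; rewrite /= /concat.
by case: split_ordP => [[]//|j /(congr1 val) /= ij]; congr u; exact: val_inj.
Qed.

Lemma gmul1r n (x : E n) : gmul n x (tp_pure E (fun _ : 'I_0 => 0)) = x.
Proof.
have norm1 : `|tp_pure E (fun _ : 'I_0 => 0)| = 1 by exact: tp_norm0.
apply: (@eq_linear_pure n _ (fun x => gmul n x (tp_pure E (fun _ : 'I_0 => 0)))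
  id 1) => //.
- exact: gmul_linearl.
- by move=> y; rewrite (le_trans (norm_gmul _ _ _))// norm1 mulr1 mul1r.
- by move=> y; rewrite mul1r.
move=> u; rewrite (gmulE (addn0 n)) tp_mul_pure tcast_pure; congr tp_pure.
apply/funext => i; rewrite /= /concat.
by case: split_ordP => [j /(congr1 val) /= ij|[]//]; congr u; exact: val_inj.
Qed.

End GradedProduct.

Section TruncatedProduct.
Context {R : realType} {V : completeNormedModType R} (E : tensorPowers V).
Variable k : nat.
Implicit Types a b c : truncTensor E k.

Lemma tmulE a b i : tmul a b i = \sum_(m < k.+1) \sum_(n < k.+1) gmul i (a m) (b n).
Proof.
(* Only indices at most [i] are used, where [inord] is faithful. *)
pose F j := gmul i (a (inord j)) (b (inord (i - j))).
transitivity (\sum_(j < i.+1) F j).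
  apply: eq_bigr => j _; rewrite -gmulE /F.
  have jk : (j < k.+1)%N by exact: leq_trans (ltn_ord j) (ltn_ord i).
  have -> : inord j = widen_ord (ltn_ord i) j.
    by apply/val_inj; rewrite /= inordK.
  have -> // : inord (i - j) =
      Ordinal (leq_ltn_trans (leq_subr j i) (ltn_ord i)).
  by apply/val_inj; rewrite /= inordK// (leq_ltn_trans (leq_subr j i) (ltn_ord i)).
rewrite (big_ord_widen k.+1 F (ltn_ord i)) big_mkcond/=.
apply: eq_bigr => m _; rewrite ltnS.
have [mi|mi] := leqP m i; last first.
  by rewrite big1// => n _; rewrite gmul_neq// gtn_eqF// ltn_addr.
have ik : (i - m < k.+1)%N by exact: leq_ltn_trans (leq_subr m i) (ltn_ord i).
rewrite (bigD1 (inord (i - m)))//= big1 ?addr0 => [|n nim].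
  by rewrite /F inord_val.
rewrite gmul_neq//; apply: contra nim => /eqP e; apply/eqP/val_inj.
by rewrite /= inordK// -e addKn.
Qed.

Lemma tone0 : tone E ord0 = tp_pure E (fun _ : 'I_0 => 0) :> E (ord0 : 'I_k.+1).
Proof. by []. Qed.

(** After expansion both sides are sums over three outer degrees and the degree
    of the inner product, of which only one value contributes. *)
Lemma tmulA a b c : tmul (tmul a b) c = tmul a (tmul b c).
Proof.
apply/functional_extensionality_dep => i; rewrite !tmulE.
under eq_bigr do under eq_bigr do rewrite tmulE gmul_suml.
under eq_bigr do under eq_bigr do under eq_bigr do rewrite gmul_suml.
under [RHS]eq_bigr do under eq_bigr do rewrite tmulE gmul_sumr.
under [RHS]eq_bigr do under eq_bigr do under eq_bigr do rewrite gmul_sumr.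
rewrite exchange_big/=; under eq_bigr do rewrite exchange_big/=.
under eq_bigr do under eq_bigr do rewrite exchange_big/=.
rewrite exchange_big/=.
under eq_bigr do rewrite exchange_big/=.
under [RHS]eq_bigr do rewrite exchange_big/=.
under [RHS]eq_bigr do under eq_bigr do rewrite exchange_big/=.
apply: eq_bigr => m _; apply: eq_bigr => n _; apply: eq_bigr => l _.
have [e|e] := eqVneq (m + n + l)%N i; last first.
  rewrite !big1// => q _.
    have [e'|e'] := eqVneq (n + l)%N q; last by rewrite [gmul q _ _]gmul_neq// gmul0r.
    by rewrite gmul_neq// -e' addnA.
  have [e'|e'] := eqVneq (m + n)%N q; last by rewrite [gmul q _ _]gmul_neq// gmul0l.
  by rewrite gmul_neq// -e'.
have mnk : (m + n < k.+1)%N by rewrite (leq_ltn_trans _ (ltn_ord i))// -e leq_addr.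
have nlk : (n + l < k.+1)%N by rewrite (leq_ltn_trans _ (ltn_ord i))// -e -addnA leq_addl.
rewrite (bigD1 (Ordinal mnk))//= [X in _ + X]big1 ?addr0; last first.
  move=> q qmn; rewrite [gmul q _ _]gmul_neq ?gmul0l// eq_sym.
  by apply: contra qmn => /eqP qE; apply/eqP/val_inj.
rewrite [RHS](bigD1 (Ordinal nlk))//= [X in _ = _ + X]big1 ?addr0; last first.
  move=> q qmn; rewrite [gmul q _ _]gmul_neq ?gmul0r// eq_sym.
  by apply: contra qmn => /eqP qE; apply/eqP/val_inj.
exact: gmulA.
Qed.

End TruncatedProduct.

(** * Controls and bisection *)

Section RealLemmas.
Context {R : realType}.
Implicit Types (x y M q a : R).

Lemma ler_geometric x y M q : 0 <= q -> q < 1 ->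
  (forall n, x <= M * q ^+ n + y) -> x <= y.
Proof.
move=> q0 q1 h.
have cv : M * q ^+ n + y @[n --> \oo] --> y.
  rewrite -[X in _ --> X]add0r; apply: cvgD; last exact: cvg_cst.
  by apply: cvg_geometric; rewrite ger0_norm.
rewrite -(cvg_lim _ cv)//; apply: limr_ge; first by apply/cvg_ex; exists y.
by apply: nearW => n; exact: h.
Qed.

Lemma powR_le_exp x (M a b : R) : 0 <= x -> x <= M -> 0 <= b -> b <= a ->
  x `^ a <= M `^ (a - b) * x `^ b.
Proof.
move=> x0 xM b0 ba; have [a0|a0] := eqVneq a 0.
  have -> : b = 0 by apply/eqP; rewrite eq_le b0 -a0 ba.
  by rewrite a0 subrr !powRr0 mulr1.
have -> : x `^ a = x `^ (a - b) * x `^ b by rewrite -powRD ?subrK// (negbTE a0).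
rewrite ler_wpM2r ?powR_ge0// ge0_ler_powR ?nnegrE ?subr_ge0//.
exact: le_trans xM.
Qed.

Lemma half_powR x a : 0 <= x -> (x / 2) `^ a *+ 2 = 2 `^ (1 - a) * x `^ a.
Proof.
move=> x0; rewrite powRM// ?invr_ge0// -powR_inv1// -powRrM mulN1r.
rewrite -mulr_natl mulrCA mulrC; congr (_ * _).
rewrite powRD ?powRr1//; apply/implyP; by rewrite pnatr_eq0.
Qed.

Lemma powR2_lt1 a : 1 < a -> 2 `^ (1 - a) < 1 :> R.
Proof.
move=> a1; rewrite /powR pnatr_eq0/= expR_lt1 nmulr_rlt0 ?subr_lt0//.
by rewrite ln_gt0// ltr1n.
Qed.

Lemma cvg_geometric_bound (W : completeNormedModType R) (u : nat -> W) M q :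
  0 <= q -> q < 1 ->
  (forall n m, `|u n - u m| <= M * (q ^+ n + q ^+ m)) ->
  forall n, `|u n - limn u| <= M * q ^+ n.
Proof.
move=> q0 q1 h n.
have cvM c : M * (c + q ^+ m) @[m --> \oo] --> M * c.
  apply: cvgMr; rewrite -[X in _ --> X]addr0; apply: cvgD; first exact: cvg_cst.
  by apply: cvg_expr; rewrite ger0_norm.
have cu : cvgn u.
  apply/cauchy_cvgP/cauchy_ballP => e e0.
  have e20 : 0 < e / 2 by rewrite divr_gt0.
  have /cvgrPdist_lt/(_ _ e20) := cvM 0; rewrite mulr0 => -[N _ hN].
  have hN' m : (N <= m)%N -> M * q ^+ m < e / 2.
    move=> /hN /=; rewrite sub0r normrN add0r; exact: le_lt_trans (ler_norm _).
  exists ([set v | exists2 m, (N <= m)%N & v = u m],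
    [set v | exists2 m, (N <= m)%N & v = u m]).
    by split; exists N => // m /= Nm; exists m.
  move=> [_ _] /= [[m Nm ->] [l Nl ->]]; rewrite -ball_normE /=.
  by rewrite (le_lt_trans (h _ _))// mulrDr (splitr e) ltrD// hN'.
have cn : `|u n - u m| @[m --> \oo] --> `|u n - limn u|.
  by apply: cvg_norm; apply: cvgB; [exact: cvg_cst|exact: cu].
rewrite -(cvg_lim _ cn)// -(cvg_lim _ (cvM (q ^+ n)))//.
apply: ler_lim; [by apply/cvg_ex; eexists; exact: cn|
  by apply/cvg_ex; eexists; exact: (cvM (q ^+ n))|].
by apply: nearW => m; exact: h.
Qed.

End RealLemmas.

Section Simplex.
Context {R : realType} {S T : R}.
Hypothesis hJ : S <= T.
Implicit Types s t u : R.

Definition clamp s : R := Num.min T (Num.max S s).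

Lemma seg_subproof s t :
  simplex S T (clamp s, Num.max (clamp s) (clamp t)).
Proof.
have clampS x : S <= clamp x by rewrite /clamp le_min hJ le_max lexx.
have clampT x : clamp x <= T by rewrite /clamp ge_min lexx.
by split => //=; rewrite ?le_max ?lexx// ge_max !clampT.
Qed.

(** The interval [s, t] as a point of the simplex. Clamping makes it total, and
    continuous on the whole plane, so that functions on the simplex can be handled
    as functions of two real variables. *)
Definition seg s t : simplex S T :=
  exist _ (clamp s, Num.max (clamp s) (clamp t)) (mem_set (seg_subproof s t)).

Lemma set_val_inj (a b : simplex S T) : set_val a = set_val b -> a = b.
Proof. by move=> ab; apply: val_inj. Qed.

Lemma clamp_id s : S <= s -> s <= T -> clamp s = s.
Proof. by move=> Ss sT; rewrite /clamp (max_idPr Ss) (min_idPr sT). Qed.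

Lemma seg_val s t : S <= s -> s <= t -> t <= T -> set_val (seg s t) = (s, t).
Proof.
move=> Ss st tT; rewrite set_valE /= !clamp_id//.
- by rewrite (max_idPr st).
- exact: le_trans st.
- exact: le_trans tT.
Qed.

Lemma simplex_seg (a : simplex S T) : exists s t,
  [/\ S <= s, s <= t, t <= T & a = seg s t].
Proof.
have [Ss st tT] := set_mem (valP a).
exists (val a).1, (val a).2; split => //; apply: set_val_inj.
by rewrite seg_val// set_valE; case: (val a).
Qed.

Lemma seg_continuous : continuous (fun z : R * R => seg z.1 z.2).
Proof.
have cc : continuous clamp.
  move=> x; apply: continuous_min; first exact: cvg_cst.
  by apply: continuous_max; [exact: cvg_cst|exact: cvg_id].
have h : continuous (set_val \o (fun z : R * R => seg z.1 z.2)).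
  move=> z.
  have c1 : {for z, continuous (fun y : R * R => clamp y.1)}.
    by apply: (@continuous_comp _ _ _ fst clamp); [exact: cvg_fst|exact: cc].
  have c2 : {for z, continuous (fun y : R * R => clamp y.2)}.
    by apply: (@continuous_comp _ _ _ snd clamp); [exact: cvg_snd|exact: cc].
  exact: (cvg_pair c1 (continuous_max c1 c2)).
exact: (continuous_comp_initial h).
Qed.

Lemma splits_seg s u t : S <= s -> s <= u -> u <= t -> t <= T ->
  splits (seg s t) (seg s u) (seg u t).
Proof.
move=> Ss su ut tT.
have [st uT Su] := And3 (le_trans su ut) (le_trans ut tT) (le_trans Ss su).
by rewrite /splits !seg_val.
Qed.

Lemma splits_segP (c a b : simplex S T) : splits c a b -> exists s u t,
  [/\ S <= s, s <= u, u <= t & t <= T] /\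
  [/\ c = seg s t, a = seg s u & b = seg u t].
Proof.
move=> [e1 e2 e3]; have [Sa abn aT] := set_mem (valP a).
have [Sb bb bT] := set_mem (valP b).
have [Sc cc cT] := set_mem (valP c).
move: e1 e2 e3; rewrite !set_valE => e1 e2 e3.
exists (val a).1, (val a).2, (val b).2; split; first by split => //; rewrite e2.
have pe (z : R * R) : z = (z.1, z.2) by case: z.
split; apply: set_val_inj; rewrite seg_val//= ?set_valE; rewrite ?e2//.
- by rewrite [LHS]pe e1 e3.
- by rewrite e1 e3.
Qed.

Section Control.
Context (w : simplex S T -> R) (hw : control w).

Lemma control_diag_seg s : S <= s -> s <= T -> w (seg s s) = 0.
Proof. by move=> Ss sT; apply: (control_diag hw); rewrite seg_val. Qed.

Lemma control_split s u t : S <= s -> s <= u -> u <= t -> t <= T ->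
  w (seg s u) + w (seg u t) <= w (seg s t).
Proof. by move=> *; apply: (control_superadd hw); exact: splits_seg. Qed.

Lemma control_mono s s' t' t : S <= s -> s <= s' -> s' <= t' -> t' <= t ->
  t <= T -> w (seg s' t') <= w (seg s t).
Proof.
move=> Ss ss st tt tT.
rewrite (le_trans _ (@control_split s s' t _ _ _ _))//; last exact: le_trans tt.
rewrite ler_wpDl// ?(control_ge0 hw)//.
rewrite (le_trans _ (@control_split s' t' t _ _ _ _))//; last exact: le_trans ss.
by rewrite ler_wpDr// (control_ge0 hw).
Qed.

Lemma control_le (a : simplex S T) : w a <= w (seg S T).
Proof. by have [s [t [Ss st tT ->]]] := simplex_seg a; exact: control_mono. Qed.

(** By continuity some [u] halves [w] on the left, and then superadditivity
    bounds what is left on the right. *)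
Lemma control_halve s t : S <= s -> s <= t -> t <= T -> exists u,
  [/\ s <= u, u <= t, w (seg s u) <= w (seg s t) / 2
    & w (seg u t) <= w (seg s t) / 2].
Proof.
move=> Ss st tT; have w0 := control_ge0 hw (seg s t).
have sT := le_trans st tT.
have cf : continuous (fun u => w (seg s u)).
  move=> u; apply: (@continuous_comp _ _ _ (fun u => seg s u) w);
    last exact: (control_continuous hw).
  apply: (@continuous_comp _ _ _ (fun u : R => (s, u)) (fun z => seg z.1 z.2));
    last exact: seg_continuous.
  exact: (cvg_pair (cvg_cst s) cvg_id).
have [] := @IVT R (fun u => w (seg s u)) s t (w (seg s t) / 2) st.
- exact: continuous_subspaceT.
- have wh : w (seg s t) / 2 <= w (seg s t).
    by rewrite ler_pdivrMr// ler_peMr// ler1n.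
  by rewrite control_diag_seg// ge_min le_max divr_ge0//= wh orbT.
move=> u; rewrite in_itv/= => /andP[su ut] wu; exists u; split => //.
  by rewrite wu.
rewrite -(lerD2l (w (seg s u))) {2}wu -splitr; exact: control_split.
Qed.

(** Halving [w] improves the constant [A] of the a priori bound by the factor
    [2^(1-a) < 1]; iterating leaves only the contribution of the defect [C w^b]. *)
Lemma subadditive_bound (f : simplex S T -> R) (A C a b : R) :
  1 < a -> 1 < b -> 0 <= C ->
  (forall c d e, splits c d e -> f c <= f d + f e + C * w c `^ b) ->
  (forall c, f c <= A * w c `^ a) ->
  forall c, f c <= C / (1 - 2 `^ (1 - b)) * w c `^ b.
Proof.
move=> a1 b1 C0 fadd fA c.
have a0 : 0 < a by exact: lt_trans a1.
have b0 : 0 < b by exact: lt_trans b1.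
(* [B] is the fixed point of [B |-> qb B + C]. *)
set B := C / _; set qb := (2 : R) `^ (1 - b) in B *; pose qa := (2 : R) `^ (1 - a).
have qb1 : 0 < 1 - qb by rewrite subr_gt0 powR2_lt1.
have B0 : 0 <= B by rewrite divr_ge0// ltW.
have BE : B * qb + C = B.
  have CE : C = B * (1 - qb) by rewrite /B divfK// gt_eqF.
  by rewrite [X in _ + X]CE mulrBr mulr1 addrC subrK.
apply: (@ler_geometric _ _ _ (`|A| * w c `^ a) qa); rewrite ?powR_ge0 ?powR2_lt1//.
move=> n; rewrite mulrAC.
elim: n c => [|n IH] c.
  rewrite expr0 mulr1 (le_trans (fA _))//; apply: ler_wpDr.
    by rewrite mulr_ge0 ?powR_ge0.
  by rewrite ler_wpM2r ?powR_ge0// ler_norm.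
have [s [t [Ss st tT ->]]] := simplex_seg c.
have [u [su ut wsu wut]] := control_halve Ss st tT.
have step d : w d <= w (seg s t) / 2 ->
    f d <= `|A| * qa ^+ n * (w (seg s t) / 2) `^ a + B * (w (seg s t) / 2) `^ b.
  move=> wd; rewrite (le_trans (IH d))// lerD// ler_wpM2l// ?mulr_ge0 ?exprn_ge0 ?powR_ge0//;
  by rewrite ge0_ler_powR ?nnegrE ?(control_ge0 hw) ?divr_ge0 ?(control_ge0 hw)// ltW.
have hs := splits_seg Ss su ut tT.
rewrite (le_trans (fadd _ _ _ hs))//.
rewrite (le_trans (lerD (lerD (step _ wsu) (step _ wut)) (lexx _)))//.
rewrite -mulr2n mulrnDl -!mulrnAr !half_powR ?(control_ge0 hw)// -addrA.
rewrite exprSr !mulrA lerD2l -mulrDl BE//.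
Qed.

End Control.

End Simplex.

(** * Sewing of additive cocycles *)

Lemma subseq_cons_split (A : eqType) (x : A) (l l' : seq A) :
  subseq (x :: l) l' -> exists l1 l2, l' = l1 ++ x :: l2 /\ subseq l l2.
Proof.
elim: l' => [|y l' IH]//=; case: eqP => [<-|_] h; first by exists [::], l'.
by have [l1 [l2 [-> ?]]] := IH h; exists (y :: l1), l2.
Qed.

Section AdditiveSewing.
Context {R : realType} {S T : R} (hJ : S <= T) (w : simplex S T -> R) (hw : control w).
Context {W : completeNormedModType R} (d : R -> R -> R -> W) (K theta : R).
Hypothesis K0 : 0 <= K.
Hypothesis theta1 : 1 < theta.
Hypothesis d_cocycle : forall s u t v,
  S <= s -> s <= u -> u <= t -> t <= v -> v <= T ->
  d s t v + d s u t = d s u v + d u t v.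
Hypothesis d_bound : forall s u t, S <= s -> s <= u -> u <= t -> t <= T ->
  `|d s u t| <= K * w (seg hJ s t) `^ theta.

Local Notation om s t := (w (seg hJ s t)).

(** When [d s u t] is the difference between [X s u * X u t] and [X s t], this
    telescopes to the difference between the product of [X] along the subdivision
    [s, l, t] and [X s t]. *)
Fixpoint defect (s : R) (l : seq R) (t : R) : W :=
  if l is x :: l' then d s x t + defect x l' t else 0.

(** Controls the effect of refining a subdivision on its defect. *)
Fixpoint mass (s : R) (l : seq R) (t : R) : R :=
  if l is x :: l' then om s x `^ theta + mass x l' t else om s t `^ theta.

Definition subdiv (s : R) (l : seq R) (t : R) := path <=%R s (rcons l t).

Lemma subdiv_cat s l1 x l2 t :
  subdiv s (l1 ++ x :: l2) t = subdiv s l1 x && subdiv x l2 t.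
Proof. by rewrite /subdiv rcons_cat -cat_rcons cat_path last_rcons. Qed.

Lemma subdiv_cons s x l t : subdiv s (x :: l) t = (s <= x) && subdiv x l t.
Proof. by []. Qed.

Lemma subdiv_le s l t : subdiv s l t -> s <= t.
Proof.
rewrite /subdiv (path_sortedE le_trans) all_rcons => /andP[/andP[]].
by [].
Qed.

Lemma subdiv_merge s l l' t : subdiv s l t -> subdiv s l' t ->
  subdiv s (sort <=%R (l ++ l')) t.
Proof.
rewrite /subdiv !(path_sortedE le_trans) !(sorted_pairwise le_trans).
rewrite !pairwise_rcons !all_rcons !all_sort !all_cat.
rewrite -(sorted_pairwise le_trans (sort _ _)) sort_sorted ?andbT; last exact: le_total.
by move=> /andP[/andP[-> ->] /andP[-> _]] /andP[/andP[_ ->] /andP[-> _]].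
Qed.

Lemma subdiv_sorted s l t : subdiv s l t -> sorted <=%R l.
Proof.
rewrite /subdiv (path_sortedE le_trans) (sorted_pairwise le_trans) pairwise_rcons.
by rewrite -(sorted_pairwise le_trans) => /andP[_ /andP[]].
Qed.

Lemma defect_cat s l1 x l2 t : S <= s -> t <= T -> subdiv s (l1 ++ x :: l2) t ->
  defect s (l1 ++ x :: l2) t = defect s l1 x + defect x l2 t + d s x t.
Proof.
move=> + tT; elim: l1 s => [|y l1 IH] s Ss /=; first by rewrite add0r addrC.
rewrite subdiv_cons => /andP[sy h].
have Sy := le_trans Ss sy; rewrite IH//.
move: h; rewrite subdiv_cat => /andP[/subdiv_le yx /subdiv_le xt].
rewrite addrCA -d_cocycle// -[X in _ = X + _]addrA -[RHS]addrA [RHS]addrCA.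
by rewrite [in RHS](addrC (d s y x)).
Qed.

Lemma mass_cat s l1 x l2 t :
  mass s (l1 ++ x :: l2) t = mass s l1 x + mass x l2 t.
Proof. by elim: l1 s => [|y l1 IH] s //=; rewrite IH addrA. Qed.

Let q := (2 : R) `^ (1 - theta).
(* The solution of [C = q C + 2 K]. *)
Let C := K *+ 2 / (1 - q).

Let q0 : 0 <= q. Proof. exact: powR_ge0. Qed.
Let q1 : q < 1. Proof. exact: powR2_lt1. Qed.
Let theta0 : 0 < theta. Proof. exact: lt_trans theta1. Qed.
Let C0 : 0 <= C.
Proof. by rewrite divr_ge0 ?mulrn_wge0// subr_ge0 ltW. Qed.
Let CE : K *+ 2 = C * (1 - q).
Proof. by rewrite divfK// gt_eqF// subr_gt0. Qed.

Lemma om_ge0 s t : 0 <= om s t. Proof. exact: control_ge0 hw _. Qed.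

Let powR_mono (x y : R) : 0 <= x -> x <= y -> x `^ theta <= y `^ theta.
Proof.
move=> x0 xy; rewrite ge0_ler_powR ?nnegrE//; first exact: ltW.
exact: le_trans xy.
Qed.

(** Cutting a subdivision where it crosses half of the control splits its
    defect into the defects of two subdivisions with half the control, and two
    terms [d]; since [2 (w/2)^theta = q w^theta] with [q < 1], a bound which
    does not depend on the number of points propagates by induction. *)
Lemma defect_bound s l t : S <= s -> t <= T -> subdiv s l t ->
  `|defect s l t| <= C * om s t `^ theta.
Proof.
have [n ln] := ubnP (size l); elim: n => // n IH in s l t ln *; move=> Ss tT hl.
have st := subdiv_le hl.
have om2 x y : om x y <= om s t / 2 ->
    C * om x y `^ theta <= C * (om s t / 2) `^ theta.
  by move=> h; rewrite ler_wpM2l// powR_mono ?om_ge0.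
have omK x y z : s <= x -> x <= y -> y <= z -> z <= t ->
    `|d x y z| <= K * om s t `^ theta.
  move=> sx xy yz zt; rewrite (le_trans (d_bound _ _ _ _))//.
  - exact: le_trans sx.
  - exact: le_trans tT.
  rewrite ler_wpM2l// powR_mono ?om_ge0//.
  by apply: (control_mono _ hw) => //; exact: le_trans yz.
have total : C * om s t `^ theta =
    (C * (om s t / 2) `^ theta + K * om s t `^ theta) *+ 2.
  rewrite mulrnDl -mulrnAr half_powR ?om_ge0// -mulrnAl -/q mulrA -mulrDl.
  by rewrite CE mulrBr mulr1 addrC subrK.
(* A subdivision whose inner points do not cross half of the control. *)
have first_half l1 z : (size l1 < n.+1)%N -> subdiv s l1 z -> z <= t ->
    all (fun x => om s x <= om s t / 2) l1 ->
    `|defect s l1 z| <= C * (om s t / 2) `^ theta + K * om s t `^ theta.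
  move=> ln1 h zt; have sz := subdiv_le h.
  case/lastP: l1 ln1 h => [|l1 y] ln1 h.
    by rewrite normr0 => _; rewrite addr_ge0// mulr_ge0 ?powR_ge0.
  rewrite all_rcons => /andP[omy _].
  move: h ln1; rewrite size_rcons -cats1 => h ln1.
  have zT := le_trans zt tT.
  rewrite defect_cat//= addr0.
  move: h; rewrite subdiv_cat => /andP[h /subdiv_le yz].
  rewrite (le_trans (ler_normD _ _))// lerD//; last first.
    by apply: omK => //; exact: subdiv_le h.
  by rewrite (le_trans (IH _ _ _ _ _ _ h))// ?om2// (le_trans yz).
have [/negP/negP nall|all2] := boolP (has (fun x => om s t / 2 < om s x) l); last first.
  rewrite total mulr2n (le_trans (first_half l t _ hl _ _))//.
    by apply/allP => x xl; rewrite leNgt; apply: contra all2 => h; apply/hasP; exists x.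
  by rewrite ler_wpDr// addr_ge0// mulr_ge0 ?powR_ge0.
(* [x] is the first point beyond half of the control. *)
case/split_find: nall ln hl => x l1 l2 xh nh.
rewrite cat_rcons => ln hl; rewrite defect_cat//.
move: hl; rewrite subdiv_cat => /andP[hl1 hl2].
have xt := subdiv_le hl2; have sx := subdiv_le hl1; have Sx := le_trans Ss sx.
rewrite total mulr2n -addrA (le_trans (ler_normD _ _))// lerD//.
  apply: first_half => //.
    by move: ln; rewrite size_cat; apply: leq_trans; rewrite ltnS leq_addr.
  by apply/allP => y yl; rewrite leNgt; apply: contra nh => h; apply/hasP; exists y.
rewrite (le_trans (ler_normD _ _))// lerD// ?omK//.
rewrite (le_trans (IH _ _ _ _ _ _ hl2))//.
  by move: ln; rewrite size_cat /= addnS ltnS; apply: leq_trans; rewrite ltnS leq_addl.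
apply: om2; rewrite -(lerD2l (om s x)) (le_trans (control_split _ hw _ _ _ _))//.
by rewrite {1}(splitr (om s t)) lerD2r ltW.
Qed.

(** Refining a subdivision changes its defect by the defects inside its
    intervals. *)
Lemma defect_refine s l l' t : S <= s -> t <= T -> subdiv s l' t -> subseq l l' ->
  `|defect s l' t - defect s l t| <= C * mass s l t.
Proof.
move=> + tT; elim: l s l' => [|x l IH] s l' Ss hl'.
  by rewrite subr0 => _; exact: defect_bound.
case/subseq_cons_split => l1 [l2 [l'E ll2]]; rewrite l'E in hl' *.
rewrite defect_cat//=; move: hl'; rewrite subdiv_cat => /andP[hl1 hl2].
have sx := subdiv_le hl1; have xt := subdiv_le hl2.
rewrite addrKA -addrA mulrDr.
rewrite (le_trans (ler_normD _ _))// lerD//.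
  by rewrite defect_bound// (le_trans xt).
by rewrite IH// (le_trans Ss).
Qed.

Lemma defect_compare s l l' t : S <= s -> t <= T -> subdiv s l t -> subdiv s l' t ->
  `|defect s l t - defect s l' t| <= C * (mass s l t + mass s l' t).
Proof.
move=> Ss tT hl hl'; set m := sort <=%R (l ++ l').
have hm : subdiv s m t by exact: subdiv_merge.
have lm : subseq l m.
  apply: sorted_subseq_sort_le; [exact: prefix_subseq|exact: subdiv_sorted hl].
have lm' : subseq l' m.
  apply: sorted_subseq_sort_le; [exact: suffix_subseq|exact: subdiv_sorted hl'].
rewrite -(subrKA (defect s m t)) (le_trans (ler_normD _ _))// mulrDr lerD//.
  by rewrite distrC defect_refine.
exact: defect_refine.
Qed.

Definition mid s t : R := xget s [set u | [/\ s <= u, u <= t,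
  om s u <= om s t / 2 & om u t <= om s t / 2]].

Lemma midP s t : S <= s -> s <= t -> t <= T ->
  [/\ s <= mid s t, mid s t <= t, om s (mid s t) <= om s t / 2
    & om (mid s t) t <= om s t / 2].
Proof.
move=> Ss st tT; rewrite /mid; case: xgetP => // h.
by have [u /h] := control_halve hJ hw Ss st tT.
Qed.

Fixpoint halvings n s t : seq R :=
  if n is m.+1 then halvings m s (mid s t) ++ mid s t :: halvings m (mid s t) t
  else [::].

Lemma halvings_subdiv n s t : S <= s -> s <= t -> t <= T -> subdiv s (halvings n s t) t.
Proof.
elim: n s t => [|n IH] s t Ss st tT /=; first by rewrite /subdiv /= st.
have [su ut _ _] := midP Ss st tT.
by rewrite subdiv_cat !IH// ?(le_trans ut)// (le_trans Ss).
Qed.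

Lemma halvings_mass n s t : S <= s -> s <= t -> t <= T ->
  mass s (halvings n s t) t <= q ^+ n * om s t `^ theta.
Proof.
elim: n s t => [|n IH] s t Ss st tT /=; first by rewrite expr0 mul1r.
have [su ut h1 h2] := midP Ss st tT.
have step x y : om x y <= om s t / 2 ->
    q ^+ n * om x y `^ theta <= q ^+ n * (om s t / 2) `^ theta.
  by move=> h; rewrite ler_wpM2l ?exprn_ge0// powR_mono ?om_ge0.
rewrite mass_cat exprSr -mulrA -half_powR ?om_ge0// mulrnAr mulr2n lerD//.
  by rewrite (le_trans (IH _ _ _ _ _))// ?step// (le_trans ut).
by rewrite (le_trans (IH _ _ _ _ _))// ?step// (le_trans Ss).
Qed.

(** The masses of successive halvings decay like [q^n], so that the defects along
    them form a Cauchy sequence. Its limit [F] has coboundary [d]: for any [u],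
    the halvings of [[s, u]] and of [[u, t]] together subdivide [[s, t]], with a
    mass that decays as well. *)
Lemma additive_sewing : exists F : R -> R -> W,
  (exists2 B, 0 <= B & forall s t, S <= s -> s <= t -> t <= T ->
     `|F s t| <= B * om s t `^ theta) /\
  (forall s u t, S <= s -> s <= u -> u <= t -> t <= T ->
     F s t = F s u + F u t + d s u t).
Proof.
pose Fn s t n := defect s (halvings n s t) t.
pose F s t := limn (Fn s t).
have FnF s t n : S <= s -> s <= t -> t <= T ->
    `|Fn s t n - F s t| <= C * om s t `^ theta * q ^+ n.
  move=> Ss st tT; apply: cvg_geometric_bound => // i j.
  rewrite (le_trans (defect_compare _ _ _ _))//; try exact: halvings_subdiv.
  by rewrite -mulrA ler_wpM2l// mulrDr lerD// mulrC halvings_mass.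
exists F; split.
  exists (C *+ 2); first by rewrite mulrn_wge0.
  move=> s t Ss st tT; have := FnF s t 0%N Ss st tT.
  rewrite expr0 mulr1 /Fn /= sub0r normrN => h.
  by rewrite mulrnAl mulr2n ler_wpDr// mulr_ge0// powR_ge0.
move=> s u t Ss su ut tT.
have [st Su uT] := And3 (le_trans su ut) (le_trans Ss su) (le_trans ut tT).
apply/eqP; rewrite -subr_eq0 -normr_le0.
set M := om s t `^ theta.
have omM x y : s <= x -> x <= y -> y <= t -> om x y `^ theta <= M.
  by move=> sx xy yt; rewrite powR_mono ?om_ge0//; apply: (control_mono _ hw).
apply: (@ler_geometric _ _ _ ((C * M) *+ 6) q) => // n; rewrite addr0.
have hD : subdiv s (halvings n s u ++ u :: halvings n u t) t.
  by rewrite subdiv_cat !halvings_subdiv.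
have FM x y : s <= x -> x <= y -> y <= t -> `|Fn x y n - F x y| <= C * M * q ^+ n.
  move=> sx xy yt; rewrite (le_trans (FnF _ _ _ _ _ _)) ?(le_trans Ss) ?(le_trans yt)//.
  by rewrite ler_wpM2r ?exprn_ge0// ler_wpM2l// omM.
have massM x y : s <= x -> x <= y -> y <= t ->
    C * mass x (halvings n x y) y <= C * M * q ^+ n.
  move=> sx xy yt; rewrite -mulrA ler_wpM2l//.
  rewrite (le_trans (halvings_mass _ _ _ _)) ?(le_trans Ss) ?(le_trans yt)//.
  by rewrite mulrC ler_wpM2r ?exprn_ge0// omM.
have cmp : `|Fn s t n - (Fn s u n + Fn u t n + d s u t)| <= (C * M * q ^+ n) *+ 3.
  rewrite -defect_cat// (le_trans (defect_compare _ _ _ hD))//.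
    exact: halvings_subdiv.
  by rewrite mass_cat !mulrDr !mulrS addr0 !lerD// massM.
have DE : (Fn s u n + Fn u t n + d s u t) - (F s u + F u t + d s u t) =
    (Fn s u n - F s u) + (Fn u t n - F u t).
  by rewrite [X in _ - X]addrC addrKA opprD addrACA.
have -> : F s t - (F s u + F u t + d s u t) = (F s t - Fn s t n) +
    ((Fn s t n - (Fn s u n + Fn u t n + d s u t)) +
     ((Fn s u n + Fn u t n + d s u t) - (F s u + F u t + d s u t))).
  by rewrite !subrKA.
rewrite DE.
(* One term for [F s t], three for the comparison, two for [F s u], [F u t]. *)
have -> : (C * M) *+ 6 * q ^+ n =
    C * M * q ^+ n + ((C * M * q ^+ n) *+ 3 + (C * M * q ^+ n + C * M * q ^+ n)).
  by rewrite mulrnAl -[6%N]/(1 + (3 + 2))%N !mulrnDr mulr1n mulr2n.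
rewrite (le_trans (ler_normD _ _))// lerD//; first by rewrite distrC FM.
rewrite (le_trans (ler_normD _ _))// lerD//.
by rewrite (le_trans (ler_normD _ _))// lerD// FM.
Qed.

End AdditiveSewing.

(** * Orders of magnitude and the cross terms of a product *)

Section BigO.
Context {R : realType} {I : Type} (om : I -> R).
Implicit Types (f g : I -> R) (a b : R).

(** Landau's O(om^a), with one constant for all [i] rather than along a filter. *)
Definition ordO a f := exists2 C, 0 <= C & forall i, f i <= C * om i `^ a.

Lemma ordO_le a f g : (forall i, f i <= g i) -> ordO a g -> ordO a f.
Proof. by move=> fg [C C0 h]; exists C => // i; exact: le_trans (h i). Qed.

Lemma ordO_cst a f : (forall i, f i = 0) -> ordO a f.
Proof. by move=> f0; exists 0 => // i; rewrite f0 mul0r. Qed.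

Lemma ordOD a f g : ordO a f -> ordO a g -> ordO a (fun i => f i + g i).
Proof.
move=> [C C0 hC] [D D0 hD]; exists (C + D); first exact: addr_ge0.
by move=> i; rewrite mulrDl lerD.
Qed.

Lemma ordO_sum a (J : Type) (r : seq J) (P : pred J) (f : J -> I -> R) :
  (forall j, P j -> ordO a (f j)) -> ordO a (fun i => \sum_(j <- r | P j) f j i).
Proof.
move=> h; elim: r => [|j r IH]; first by apply: ordO_cst => i; rewrite big_nil.
have [Pj|Pj] := boolP (P j).
  by apply: ordO_le (ordOD (h j Pj) IH) => i; rewrite big_cons Pj.
by apply: ordO_le IH => i; rewrite big_cons (negbTE Pj).
Qed.

Lemma ordOM a b f g : 0 < a + b -> (forall i, 0 <= f i) -> (forall i, 0 <= g i) ->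
  ordO a f -> ordO b g -> ordO (a + b) (fun i => f i * g i).
Proof.
move=> ab f0 g0 [C C0 hC] [D D0 hD]; exists (C * D); first exact: mulr_ge0.
move=> i; rewrite powRD ?(gt_eqF ab)//.
by rewrite mulrACA ler_pM.
Qed.

Lemma ordO_weaken M a b f : (forall i, 0 <= om i) -> (forall i, om i <= M) ->
  0 <= b -> b <= a -> ordO a f -> ordO b f.
Proof.
move=> om0 omM b0 ba [C C0 hC]; exists (C * M `^ (a - b)).
  by rewrite mulr_ge0 ?powR_ge0.
by move=> i; rewrite (le_trans (hC i))// -mulrA ler_wpM2l// powR_le_exp.
Qed.

End BigO.

Section Cross.
Context {R : realType} {V : completeNormedModType R} (E : tensorPowers V).
Variable k : nat.
Implicit Types a b c : truncTensor E k.

(** What the product of two elements with unit level 0 adds to their sum; its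
    level [i] only involves levels strictly between 0 and [i]. *)
Definition cross a b (i : 'I_k.+1) : E i :=
  \sum_(m < k.+1 | (0 < m)%N) \sum_(n < k.+1 | (0 < n)%N) gmul i (a m) (b n).

Lemma tmul_cross a b (i : 'I_k.+1) : a ord0 = tone E ord0 -> b ord0 = tone E ord0 ->
  (0 < i)%N -> tmul a b i = a i + b i + cross a b i.
Proof.
move=> a0 b0 i0; rewrite tmulE (bigD1 ord0)//= a0 tone0.
have -> : \sum_(n < k.+1) gmul i (tp_pure E (fun _ : 'I_0 => 0)) (b n) = b i.
  rewrite (bigD1 i)//= gmul1l big1 ?addr0// => n ni.
  by rewrite gmul_neq.
rewrite [a i + _]addrC -addrA; congr (_ + _).
rewrite /cross; have -> : a i = \sum_(m < k.+1 | (0 < m)%N) gmul i (a m) (b ord0).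
  rewrite (bigD1 i)//= b0 tone0 gmul1r big1 ?addr0// => m /andP[_ mi].
  by rewrite gmul_neq// addn0.
rewrite -big_split/=; apply: eq_big => [m|m m0]; first by rewrite lt0n.
by rewrite (bigD1 ord0)//=; congr (_ + _); apply: eq_bigl => n; rewrite lt0n.
Qed.

Lemma eq_cross a a' b b' (i : 'I_k.+1) :
  (forall j : 'I_k.+1, (0 < j < i)%N -> a j = a' j) ->
  (forall j : 'I_k.+1, (0 < j < i)%N -> b j = b' j) ->
  cross a b i = cross a' b' i.
Proof.
move=> aa bb; apply: eq_bigr => m m0; apply: eq_bigr => n n0.
have [e|e] := eqVneq (m + n)%N i; last by rewrite !gmul_neq.
by rewrite aa ?bb// -e ?m0 ?n0/= -[X in (X < _)%N]addn0 ?ltn_add2l// addnC ltn_add2r.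
Qed.

Lemma crossDl a a' b i : cross (fun j => a j + a' j) b i = cross a b i + cross a' b i.
Proof.
rewrite /cross -big_split/=; apply: eq_bigr => m _; rewrite -big_split/=.
by apply: eq_bigr => n _; rewrite gmulDl.
Qed.

Lemma crossDr a b b' i : cross a (fun j => b j + b' j) i = cross a b i + cross a b' i.
Proof.
rewrite /cross -big_split/=; apply: eq_bigr => m _; rewrite -big_split/=.
by apply: eq_bigr => n _; rewrite gmulDr.
Qed.

Lemma crossBl a a' b i : cross (fun j => a j - a' j) b i = cross a b i - cross a' b i.
Proof.
rewrite /cross -sumrB; apply: eq_bigr => m _; rewrite -sumrB.
by apply: eq_bigr => n _; rewrite gmulBl.
Qed.

Lemma crossBr a b b' i : cross a (fun j => b j - b' j) i = cross a b i - cross a b' i.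
Proof.
rewrite /cross -sumrB; apply: eq_bigr => m _; rewrite -sumrB.
by apply: eq_bigr => n _; rewrite gmulBr.
Qed.

Lemma norm_cross a b i : `|cross a b i| <=
  \sum_(m < k.+1 | (0 < m)%N) \sum_(n < k.+1 | (0 < n)%N) `|gmul i (a m) (b n)|.
Proof.
rewrite (le_trans (ler_norm_sum _ _ _))//; apply: ler_sum => m _.
exact: ler_norm_sum.
Qed.

Section Order.
Context {I : Type} (om : I -> R).

Lemma ordO_cross al be (A B : I -> truncTensor E k) (i : 'I_k.+1) : 0 < al + be ->
  (forall m : 'I_k.+1, (0 < m)%N -> ordO om al (fun x => `|A x m|)) ->
  (forall n : 'I_k.+1, (0 < n)%N -> ordO om be (fun x => `|B x n|)) ->
  ordO om (al + be) (fun x => `|cross (A x) (B x) i|).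
Proof.
move=> ab hA hB; apply: ordO_le (fun x => norm_cross (A x) (B x) i) _.
apply: ordO_sum => m m0; apply: ordO_sum => n n0.
apply: ordO_le (fun x => norm_gmul i (A x m) (B x n)) _.
by apply: ordOM => //; [exact: hA|exact: hB].
Qed.

Lemma ordO_cross_graded r (A B : I -> truncTensor E k) (i : 'I_k.+1) : 0 < r ->
  (forall m : 'I_k.+1, (0 < m < i)%N -> ordO om (m%:R * r) (fun x => `|A x m|)) ->
  (forall n : 'I_k.+1, (0 < n < i)%N -> ordO om (n%:R * r) (fun x => `|B x n|)) ->
  ordO om (i%:R * r) (fun x => `|cross (A x) (B x) i|).
Proof.
move=> r0 hA hB; apply: ordO_le (fun x => norm_cross (A x) (B x) i) _.
apply: ordO_sum => m m0; apply: ordO_sum => n n0.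
have [e|e] := eqVneq (m + n)%N i; last first.
  by apply: ordO_cst => x; rewrite gmul_neq// normr0.
apply: ordO_le (fun x => norm_gmul i (A x m) (B x n)) _.
rewrite -{1}e natrD mulrDl; apply: ordOM => //.
- by rewrite addr_gt0// mulr_gt0// ltr0n.
- by apply: hA; rewrite m0 -e -[X in (X < _)%N]addn0 ltn_add2l.
- by apply: hB; rewrite n0 -e -[X in (X < _)%N]add0n ltn_add2r.
Qed.

End Order.
End Cross.

(** * Positivity of the normalizing constants *)

Section Constants.
Context {R : realType}.

(** Take logarithms and use [ln y <= y - 1] for [y = t / (2 x)]. *)
Lemma powR_expR_le (x t : R) : 0 < x -> 0 < t ->
  t `^ x * expR (- t) <= (2 * x) `^ x * expR (- 2^-1 * t).
Proof.
move=> x0 t0; have y0 : 0 < 2 * x by rewrite mulr_gt0.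
rewrite /powR !gt_eqF// -!expRD ler_expR.
have -> : t = (t / (2 * x)) * (2 * x) by rewrite divfK// gt_eqF.
set y := t / (2 * x); have yp : 0 < y by rewrite divr_gt0.
have lny : ln y <= y - 1.
  have := @le_ln1Dx R (y - 1); rewrite addrCA subrr addr0; apply.
  by rewrite ltrBrDl subrr.
rewrite lnM ?posrE//.
have : x * ln y <= x * y by rewrite ler_wpM2l ?(ltW x0)// (le_trans lny)// gerBl.
by lra.
Qed.

(** The integrand is at most a multiple of an exponential density of rate 1/2,
    which makes the integral finite, and is positive on [1, 2]. *)
Lemma rfact_gt0 (x : R) : 0 < x -> 0 < rfact x.
Proof.
move=> x0; rewrite /rfact /Gamma /Rintegral addrK.
set mu := lebesgue_measure; set D := `]0, +oo[%classic.
pose f t := t `^ x * expR (- t) : R.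
pose B := (2 * x) `^ x * 2.
have f0 t : 0 <= f t by rewrite mulr_ge0 ?powR_ge0 ?expR_ge0.
have mf : measurable_fun setT f.
  apply: measurable_funM; first exact: measurable_powR.
  by apply: measurableT_comp => //; exact: measurable_expR.
have mD : measurable D by exact: measurable_itv.
have mEf A : measurable_fun A (EFin \o f) by apply/measurable_EFinP; exact: measurable_funTS.
have B0 : 0 <= B by rewrite mulr_ge0 ?powR_ge0.
have h2 : 0 < 2^-1 :> R by rewrite invr_gt0.
apply: fine_gt0; apply/andP; split.
  have sub12 : `[1, 2]%classic `<=` D.
    by move=> t; rewrite /D /= !in_itv/= => /andP[t1 _]; rewrite andbT (lt_le_trans _ t1).
  apply: (@lt_le_trans _ _ (\int[mu]_(t in `[1%R, 2%R]) (f t)%:E)%E); last first.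
    apply: ge0_subset_integral => //; first exact: mEf.
    by move=> t _; rewrite lee_fin.
  apply: (@lt_le_trans _ _ (\int[mu]_(t in `[1%R, 2%R]) (cst (expR (- 2))%:E t))%E).
    rewrite integral_cst//= lebesgue_measure_itv/= lte_fin ltr1n.
    by rewrite -EFinD -EFinM lte_fin mulr_gt0 ?expR_gt0// subr_gt0 ltr1n.
  apply: ge0_le_integral => //=; first exact: mEf.
  move=> t; rewrite in_itv/= => /andP[t1 t2]; rewrite lee_fin /f.
  rewrite -[leLHS]mul1r ler_pM ?expR_ge0//; last by rewrite ler_expR lerN2.
  have := @ge0_ler_powR R x (ltW x0) 1 t; rewrite !nnegrE powR1; apply => //.
  exact: le_trans t1.

have le1 : (\int[mu]_(t in D) (f t)%:E <=
    \int[mu]_(t in D) (B%:E * (exponential_pdf 2^-1 t)%:E))%E.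
  apply: ge0_le_integral => //.
  - by move=> t _; rewrite lee_fin.
  - exact: mEf.
  - apply/measurable_funeM/measurable_EFinP/measurable_funTS.
    exact: measurable_exponential_pdf.
  move=> t; rewrite /D /= in_itv/= andbT => t0; rewrite -EFinM lee_fin /f.
  rewrite (le_trans (powR_expR_le x0 t0))//.
  by rewrite exponential_pdfE ?(ltW t0)// /B -!mulrA mulVKf.
have le2 : (\int[mu]_(t in D) (B%:E * (exponential_pdf 2^-1 t)%:E) <=
    \int[mu]_t (B%:E * (exponential_pdf 2^-1 t)%:E))%E.
  apply: ge0_subset_integral => //.
  - apply/measurable_funeM/measurable_EFinP.
    exact: measurable_exponential_pdf.
  - by move=> t _; rewrite mule_ge0 ?lee_fin// exponential_pdf_ge0// ltW.
apply: le_lt_trans le1 (le_lt_trans le2 _).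
rewrite ge0_integralZl//; last 2 first.
- by apply/measurable_EFinP; exact: measurable_exponential_pdf.
- by move=> t _; rewrite lee_fin exponential_pdf_ge0// ltW.
by rewrite integral_exponential_pdf// mule1 ltry.
Qed.

(** The terms of the series are nonnegative, and [limn] is 0 on a divergent
    sequence of reals. *)
Lemma lyons_beta_gt0 (p : R) : 0 < p -> 0 < lyons_beta p.
Proof.
move=> p0; rewrite mulr_gt0// ltr_wpDr//.
set u := fun n => _; have [cu|/dvgP->] := pselect (cvgn u); last exact: lexx.
apply: limr_ge => //; apply: nearW => n; apply: sumr_ge0 => i _; exact: powR_ge0.
Qed.

End Constants.

(** * Estimates on paths *)

Lemma uniform_const {R : realType} (J : finType) (P : J -> R -> Prop) :
  (forall j C D, C <= D -> P j C -> P j D) ->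
  (forall j, exists2 C, 0 <= C & P j C) -> exists2 C, 0 <= C & forall j, P j C.
Proof.
move=> mono h.
have /choice[C hC] : forall j, exists C, 0 <= C /\ P j C.
  by move=> j; have [C] := h j; exists C.
exists (\sum_j C j); first by apply: sumr_ge0 => j _; have [] := hC j.
move=> j; have [_] := hC j; apply: mono.
rewrite (bigD1 j)//= lerDl; apply: sumr_ge0 => l _; by have [] := hC l.
Qed.

Section Paths.
Context {R : realType} {V : completeNormedModType R} (E : tensorPowers V).
Context {S T : R} (hJ : S <= T) (k : nat).
Local Notation tpath := (simplex S T -> truncTensor E k).
Implicit Types (X Y Z H : tpath) (p theta phi : R) (w : simplex S T -> R).

(** Estimates that hold on all intervals cut in two are estimates on functions
    of such a configuration. *)
Record triple := Triple { tc : simplex S T ; ta : simplex S T ; tb : simplex S T ;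
  tsplits : splits tc ta tb }.

Definition unital X := forall a, X a ord0 = tone E ord0.

(** Finite p-variation up to the normalizing constants; see [pvarP]. *)
Definition pvar p w X := forall i : 'I_k.+1, (0 < i)%N ->
  ordO w (i%:R / p) (fun a => `|X a i|).

Definition almost_mult theta w X := forall i : 'I_k.+1, (0 < i)%N ->
  ordO (w \o tc) theta (fun z => `|tmul (X (ta z)) (X (tb z)) i - X (tc z) i|).

Definition level_close theta w X Y := forall i : 'I_k.+1, (0 < i)%N ->
  ordO w theta (fun a => `|X a i - Y a i|).

Definition chen_at X (i : 'I_k.+1) :=
  forall a b c : simplex S T, splits c a b -> tmul (X a) (X b) i = X c i.

Lemma level_closeP theta w X Y : level_close theta w X Y <-> exists C : R,
  forall (i : 'I_k.+1) a, (0 < i)%N -> `|X a i - Y a i| <= C * w a `^ theta.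
Proof.
split=> [h|[C hC] i i0]; last first.
  exists `|C| => // a; rewrite (le_trans (hC i a i0))//.
  by rewrite ler_wpM2r ?powR_ge0// ler_norm.
have [||C C0 hC] := @uniform_const R 'I_k.+1 (fun i C => forall a, (0 < i)%N ->
    `|X a i - Y a i| <= C * w a `^ theta).
- move=> i C D CD hC a i0; rewrite (le_trans (hC a i0))//.
  by rewrite ler_wpM2r ?powR_ge0.
- move=> i; have [i0|i0] := posnP i; first by exists 0 => // a; rewrite i0.
  by have [C C0 hC] := h i i0; exists C.
by exists C => i a; exact: hC.
Qed.

(** The normalizing constants are positive, hence can be moved into [K]. *)
Lemma pvarP p w X : 0 < p ->
  pvar p w X <-> exists2 K, 0 <= K & finite_pvar_with p w K X.
Proof.
move=> p0; have D0 (i : 'I_k.+1) : (0 < i)%N -> 0 < lyons_beta p * rfact (i%:R / p).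
  by move=> i0; rewrite mulr_gt0 ?lyons_beta_gt0// rfact_gt0// divr_gt0// ltr0n.
split=> [h|[K K0 hK] i i0]; last first.
  exists (K / (lyons_beta p * rfact (i%:R / p))); first by rewrite divr_ge0// ltW// D0.
  by move=> a; rewrite mulrAC; exact: hK.
have [||K K0 hK] := @uniform_const R 'I_k.+1 (fun i K => forall a, (0 < i)%N ->
    `|X a i| <= K * w a `^ (i%:R / p) / (lyons_beta p * rfact (i%:R / p))).
- move=> i C D CD hC a i0; rewrite (le_trans (hC a i0))//.
  by rewrite ler_wpM2r ?invr_ge0 ?(ltW (D0 i i0))// ler_wpM2r ?powR_ge0.
- move=> i; have [i0|i0] := posnP i; first by exists 0 => // a; rewrite i0.
  have [C C0 hC] := h i i0.
  exists (C * (lyons_beta p * rfact (i%:R / p))); first by rewrite mulr_ge0// ltW// D0.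
  by move=> a _; rewrite mulrAC mulfK ?hC// gt_eqF// D0.
by exists K => // i a; exact: hK.
Qed.

Lemma almost_multP theta w X :
  almost_mult theta w X <-> exists2 K, 0 <= K & almost_mult_with theta w K X.
Proof.
split=> [h|[K K0 hK] i i0]; last first.
  by exists K => // z; apply: hK => //; exact: tsplits.
have [||K K0 hK] := @uniform_const R 'I_k.+1 (fun i K => forall z : triple, (0 < i)%N ->
    `|tmul (X (ta z)) (X (tb z)) i - X (tc z) i| <= K * w (tc z) `^ theta).
- move=> i C D CD hC a i0; rewrite (le_trans (hC a i0))//.
  by rewrite ler_wpM2r ?powR_ge0.
- move=> i; have [i0|i0] := posnP i; first by exists 0 => // a; rewrite i0.
  by have [C C0 hC] := h i i0; exists C.
by exists K => // i a b c i0 abc; exact: (hK i (Triple abc)).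
Qed.

Lemma Omega_amP p theta w X : 0 < p ->
  Omega_am p theta w X <-> [/\ unital X, pvar p w X & almost_mult theta w X].
Proof.
move=> p0; split=> [[X1 [K [K0 hp ha]]]|[X1]].
  by split => //; [apply/pvarP => //|apply/almost_multP]; exists K.
move=> /(pvarP w X p0) [K K0 hK] /almost_multP [L L0 hL]; split => //.
exists (K + L); split; first exact: addr_ge0.
- move=> i a i0; rewrite (le_trans (hK i a i0))//.
  rewrite ler_wpM2r ?invr_ge0//.
    by rewrite ltW// mulr_gt0 ?lyons_beta_gt0// rfact_gt0// divr_gt0// ltr0n.
  by rewrite ler_wpM2r ?powR_ge0// lerDl.
- move=> i a b c i0 abc; rewrite (le_trans (hL i a b c i0 abc))//.
  by rewrite ler_wpM2r ?powR_ge0// lerDr.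
Qed.

Lemma OmegaP p w X : 0 < p ->
  Omega p w X <-> mult_functional X /\ pvar p w X.
Proof. by move=> p0; split=> -[hX /(pvarP w X p0)]. Qed.

Section FixedControl.
Context (w : simplex S T -> R) (hw : control w).

Lemma ta_le (z : triple) : w (ta z) <= w (tc z).
Proof.
have := control_superadd hw (tsplits z).
by apply: le_trans; rewrite lerDl (control_ge0 hw).
Qed.

Lemma tb_le (z : triple) : w (tb z) <= w (tc z).
Proof.
have := control_superadd hw (tsplits z).
by apply: le_trans; rewrite lerDr (control_ge0 hw).
Qed.

Lemma ordO_restrict (g : triple -> simplex S T) al f : 0 <= al ->
  (forall z, w (g z) <= w (tc z)) ->
  ordO w al f -> ordO (w \o tc) al (fun z => f (g z)).
Proof.
move=> al0 hg [C C0 hC]; exists C => // z; rewrite (le_trans (hC _))//.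
rewrite ler_wpM2l// ge0_ler_powR ?nnegrE ?(control_ge0 hw)//; exact: hg.
Qed.

Lemma control_weaken a b f : 0 <= b -> b <= a -> ordO w a f -> ordO w b f.
Proof.
apply: ordO_weaken; first exact: (control_ge0 hw).
exact: (control_le hJ hw).
Qed.

Lemma pvar_weaken p X r (i : 'I_k.+1) : 0 < p -> pvar p w X -> (0 < i)%N ->
  0 <= r -> r <= 1 / p -> ordO w r (fun a => `|X a i|).
Proof.
move=> p0 hX i0 r0 rp; apply: control_weaken (hX i i0) => //.
by rewrite (le_trans rp)// ler_pM2r ?invr_gt0// ler1n.
Qed.

Lemma level_close_sym theta X Y : level_close theta w X Y -> level_close theta w Y X.
Proof. by move=> h i i0; apply: ordO_le (h i i0) => a; rewrite distrC. Qed.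

Lemma level_close_trans theta X Y Z :
  level_close theta w X Y -> level_close theta w Y Z -> level_close theta w X Z.
Proof.
move=> h h' i i0; apply: ordO_le (ordOD (h i i0) (h' i i0)) => a.
by rewrite -(subrKA (Y a i)) ler_normD.
Qed.

Lemma norm_sum4_perturb (N : normedModType R) (a b x c a' b' x' c' y : N) :
  `|a' + b' + x' - c'| <= `|a + b + x - c| +
    (`|a' - a| + `|b' - b| + (`|x' - y| + `|y - x|) + `|c' - c|).
Proof.
have e (u v : N) : v = u + (v - u) by rewrite addrC subrK.
rewrite [in leLHS](e a a') [in leLHS](e b b') [in leLHS](e x x') [in leLHS](e c c').
rewrite opprD (addrACA a) (addrACA (a + b)) (addrACA (a + b + x)).
rewrite (le_trans (ler_normD _ _))// lerD2l.
rewrite (le_trans (ler_normB _ _))// lerD2r.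
rewrite (le_trans (ler_normD _ _))// lerD ?ler_normD//.
by rewrite -(subrKA y) ler_normD.
Qed.

(** The defects of [Z] and [Z'] differ by differences of [Z] and [Z'] and by
    products of such a difference with a bounded factor. *)
Lemma almost_mult_close theta Z Z' : 0 < theta -> unital Z -> unital Z' ->
  (forall i : 'I_k.+1, (0 < i)%N -> ordO w 0 (fun a => `|Z a i|)) ->
  level_close theta w Z' Z -> almost_mult theta w Z -> almost_mult theta w Z'.
Proof.
move=> th0 Z1 Z1' hZ0 hZZ hZ i i0; have th0' := ltW th0.
have hZ0' (j : 'I_k.+1) : (0 < j)%N -> ordO w 0 (fun a => `|Z' a j|).
  move=> j0; have := ordOD (hZ0 j j0) (control_weaken (lexx 0) th0' (hZZ j j0)).
  by apply: ordO_le => a; rewrite -{1}(subrKC (Z a j) (Z' a j)) ler_normD.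
have la z : w (ta z) <= w (tc z) := ta_le z.
have lb z : w (tb z) <= w (tc z) := tb_le z.
apply: (@ordO_le _ _ _ _ _ (fun z => `|tmul (Z (ta z)) (Z (tb z)) i - Z (tc z) i| +
  (`|Z' (ta z) i - Z (ta z) i| + `|Z' (tb z) i - Z (tb z) i| +
   (`|cross (Z' (ta z)) (Z' (tb z)) i - cross (Z (ta z)) (Z' (tb z)) i| +
    `|cross (Z (ta z)) (Z' (tb z)) i - cross (Z (ta z)) (Z (tb z)) i|) +
   `|Z' (tc z) i - Z (tc z) i|))).
  by move=> z; rewrite !tmul_cross//; exact: norm_sum4_perturb.
apply: ordOD; first exact: hZ.
apply: ordOD; last by apply: ordO_restrict (hZZ i i0).
apply: ordOD.
  by apply: ordOD; apply: ordO_restrict (hZZ i i0).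
apply: ordOD.
  apply: (@ordO_le _ _ _ _ _
    (fun z => `|cross (fun j => Z' (ta z) j - Z (ta z) j) (Z' (tb z)) i|)).
    by move=> z; rewrite crossBl.
  rewrite -[theta]addr0; apply: ordO_cross; first by rewrite addr0.
    by move=> m m0; apply: (ordO_restrict _ la (hZZ m m0)).
  by move=> m m0; apply: (ordO_restrict _ lb (hZ0' m m0)).
apply: (@ordO_le _ _ _ _ _
  (fun z => `|cross (Z (ta z)) (fun j => Z' (tb z) j - Z (tb z) j) i|)).
  by move=> z; rewrite crossBr.
rewrite -[theta]add0r; apply: ordO_cross; first by rewrite add0r.
  by move=> m m0; apply: (ordO_restrict _ la (hZ0 m m0)).
by move=> m m0; apply: (ordO_restrict _ lb (hZZ m m0)).
Qed.

End FixedControl.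

End Paths.

(** * The rough sewing lemma *)

Section Sewing.
Context {R : realType} {V : completeNormedModType R} (E : tensorPowers V).
Context {S T : R} (hJ : S <= T) (k : nat).
Local Notation tpath := (simplex S T -> truncTensor E k).
Local Notation pt := (seg hJ).
Implicit Types (X Y Z H : tpath) (p theta phi : R) (w : simplex S T -> R).

#[local] Instance simplex_filter (a : simplex S T) : Filter (nbhs a) := nbhs_filter a.

Lemma cvg_powR0 (I : Type) (F : set_system I) {FF : Filter F} (g : I -> R) (r : R) :
  0 < r -> (forall a, 0 <= g a) -> g a @[a --> F] --> 0 -> g a `^ r @[a --> F] --> 0.
Proof.
move=> r0 g0 /cvgrPdist_lt hg; apply/cvgrPdist_lt => e e0.
have er : 0 < e `^ r^-1 by rewrite powR_gt0.
apply: filterS (hg _ er) => a /=; rewrite !sub0r !normrN.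
rewrite !ger0_norm ?powR_ge0// => h.
have -> : e = (e `^ r^-1) `^ r by rewrite -powRrM mulVf ?powRr1 ?gt_eqF// ltW.
by apply: gt0_ltr_powR => //; rewrite nnegrE// ltW.
Qed.

Lemma cvg_control_diag w (a0 : simplex S T) (f g : simplex S T -> R) (x : R) :
  control w -> S <= x -> x <= T -> f a @[a --> a0] --> x -> g a @[a --> a0] --> x ->
  w (pt (f a) (g a)) @[a --> a0] --> 0.
Proof.
move=> hw Sx xT cf cg; rewrite -(control_diag_seg hJ hw Sx xT).
have c1 : (f a, g a) @[a --> a0] --> (x, x) by exact: (cvg_pair cf cg).
have c2 : {for (x, x), continuous (fun z : R * R => pt z.1 z.2)} by exact: seg_continuous.
have c3 : {for pt x x, continuous w} by exact: (control_continuous hw).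
exact: (cvg_comp _ _ (cvg_comp _ _ c1 c2) c3).
Qed.

Lemma cvg_truncTensor (I : topologicalType) (X : I -> truncTensor E k) a :
  (forall i, (fun b => X b i) @ a --> X a i) -> X @ a --> X a.
Proof.
move=> cX; apply/cvg_sup => i U [? /= [[W oW <-] /= WX]] /filterS; apply.
by apply: (cX i); exact: open_nbhs_nbhs.
Qed.

(** Chen's relation turns smallness near the diagonal into continuity: both [a]
    and a nearby [a0] are compared with the interval that they span. *)
Lemma chen_continuous w r Y : control w -> 0 < r -> unital Y ->
  (forall i, chen_at Y i) ->
  (forall i : 'I_k.+1, (0 < i)%N -> ordO w r (fun a => `|Y a i|)) ->
  continuous Y.
Proof.
move=> hw r0 Y1 hY bY; suff cY (a0 : simplex S T) : Y @ a0 --> Y a0 by move=> a; exact: cY.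
apply: cvg_truncTensor => i.
have [i0|i0] := posnP i.
  have -> : i = ord0 by apply/val_inj.
  have -> : (fun a => Y a ord0) = (fun=> Y a0 ord0) by apply/funext => a; rewrite !Y1.
  by apply: cvg_cst; exact: (@nbhs_filter (simplex S T) a0).
have bd (g : @triple R S T -> simplex S T) (om : @triple R S T -> R) (j : 'I_k.+1) :
    (0 < j)%N -> ordO om 0 (fun z => `|Y (g z) j|).
  move=> j0; have [C C0 hC] := control_weaken hJ hw (lexx 0) (ltW r0) (bY j j0).
  by exists C => // z; have := hC (g z); rewrite !powRr0.
have restr (g : @triple R S T -> simplex S T) (j : 'I_k.+1) : (0 < j)%N ->
    ordO (w \o g) r (fun z => `|Y (g z) j|).
  by move=> /bY [C C0 hC]; exists C => // z; exact: hC.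
have [C C0 hC] : ordO (w \o @ta R S T) r (fun z => `|Y (tc z) i - Y (tb z) i|).
  apply: (@ordO_le _ _ _ _ _ (fun z => `|Y (ta z) i| + `|cross (Y (ta z)) (Y (tb z)) i|)).
    move=> z; rewrite -(hY i _ _ _ (tsplits z)) tmul_cross//.
    by rewrite addrAC addrK ler_normD.
  apply: ordOD; first exact: restr.
  rewrite -[r]addr0; apply: ordO_cross; rewrite ?addr0// => j j0; first exact: restr.
  exact: bd.
have [D D0 hD] : ordO (w \o @tb R S T) r (fun z => `|Y (tc z) i - Y (ta z) i|).
  apply: (@ordO_le _ _ _ _ _ (fun z => `|Y (tb z) i| + `|cross (Y (ta z)) (Y (tb z)) i|)).
    move=> z; rewrite -(hY i _ _ _ (tsplits z)) tmul_cross//.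
    rewrite -[_ + _ + cross _ _ _]addrA [X in `|X|]addrC addKr.
    exact: ler_normD.
  apply: ordOD; first exact: restr.
  rewrite -[r]add0r; apply: ordO_cross; rewrite ?add0r// => j j0; last exact: restr.
  exact: bd.
pose s (a : simplex S T) := (set_val a).1; pose t (a : simplex S T) := (set_val a).2.
(* [[s1 a, t1 a]] is the interval spanned by [a] and [a0]. *)
pose s1 a := Num.min (s a) (s a0); pose t1 a := Num.max (t a) (t a0).
have Ia (a : simplex S T) : [/\ S <= s a, s a <= t a, t a <= T & a = pt (s a) (t a)].
  have [x [y [Sx xy yT ->]]] := simplex_seg hJ a.
  by rewrite /s /t !seg_val.
pose G a := D * w (pt (t a) (t1 a)) `^ r + C * w (pt (s1 a) (s a)) `^ r +
  (C * w (pt (s1 a) (s a0)) `^ r + D * w (pt (t a0) (t1 a)) `^ r).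
have YG a : `|Y a0 i - Y a i| <= G a.
  have [Sa sta tTa aE] := Ia a; have [Sa0 sta0 tTa0 a0E] := Ia a0.
  have Ss1 : S <= s1 a by rewrite le_min Sa.
  have s1s : s1 a <= s a by rewrite ge_min lexx.
  have s1s0 : s1 a <= s a0 by rewrite ge_min lexx orbT.
  have tt1 : t a <= t1 a by rewrite le_max lexx.
  have t0t1 : t a0 <= t1 a by rewrite le_max lexx orbT.
  have t1T : t1 a <= T by rewrite ge_max tTa.
  have st1 : s a <= t1 a by exact: le_trans tt1.
  have s0t1 : s a0 <= t1 a by exact: le_trans t0t1.
  have h1 := hD (Triple (splits_seg hJ Sa sta tt1 t1T)).
  have h2 := hC (Triple (splits_seg hJ Ss1 s1s st1 t1T)).
  have h3 := hC (Triple (splits_seg hJ Ss1 s1s0 s0t1 t1T)).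
  have h4 := hD (Triple (splits_seg hJ Sa0 sta0 t0t1 t1T)).
  rewrite /= in h1 h2 h3 h4.
  rewrite -aE in h1; rewrite -a0E in h4; rewrite distrC /G.
  rewrite -(subrKA (Y (pt (s1 a) (t1 a)) i)) (le_trans (ler_normD _ _))// lerD//.
    rewrite -(subrKA (Y (pt (s a) (t1 a)) i)) (le_trans (ler_normD _ _))// lerD//.
      by rewrite distrC.
    by rewrite distrC.
  by rewrite -(subrKA (Y (pt (s a0) (t1 a)) i)) (le_trans (ler_normD _ _))// lerD.
have G0 : G a @[a --> a0] --> 0.
  have cs : s a @[a --> a0] --> s a0.
    exact: (cvg_comp _ _ (@initial_continuous _ _ set_val a0) (@cvg_fst _ _ _ _ _)).
  have ct : t a @[a --> a0] --> t a0.
    exact: (cvg_comp _ _ (@initial_continuous _ _ set_val a0) (@cvg_snd _ _ _ _ _)).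
  have cs1 : s1 a @[a --> a0] --> s a0.
    have h : {for a0, continuous (s \min cst (s a0))}.
      apply: continuous_min; first exact: cs.
      exact: cvg_cst.
    have h' : s1 a0 = s a0 by rewrite /s1 minxx.
    by rewrite -[X in _ --> X]h'.
  have ct1 : t1 a @[a --> a0] --> t a0.
    have h : {for a0, continuous (t \max cst (t a0))}.
      by apply: continuous_max; [exact: ct|exact: cvg_cst].
    have h' : t1 a0 = t a0 by rewrite /t1 maxxx.
    by rewrite -[X in _ --> X]h'.
  have [Sa0 sta0 tTa0 _] := Ia a0.
  have St0 := le_trans Sa0 sta0; have s0T := le_trans sta0 tTa0.
  have key B f g x : S <= x -> x <= T -> f a @[a --> a0] --> x ->
      g a @[a --> a0] --> x -> B * w (pt (f a) (g a)) `^ r @[a --> a0] --> 0.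
    move=> Sx xT cf cg; rewrite -[X in _ --> X](mulr0 B); apply: cvgMr.
    apply: cvg_powR0 => //; first by move=> a; exact: control_ge0 hw _.
    exact: (cvg_control_diag hw Sx xT).
  rewrite -[X in _ --> X]addr0 -[X in _ --> _ + X]addr0 -[X in _ --> X + _]addr0.
  apply: cvgD.
    by apply: cvgD; [apply: (key D t t1 (t a0))|apply: (key C s1 s (s a0))].
  apply: cvgD; first by apply: (key C s1 (cst (s a0)) (s a0)) => //; exact: cvg_cst.
  by apply: (key D (cst (t a0)) t1 (t a0)) => //; exact: cvg_cst.
apply/cvgrPdist_lt => e e0; move/cvgrPdist_lt: G0 => /(_ e e0).
apply: filterS => a; rewrite sub0r normrN => Ge.
by rewrite (le_lt_trans (YG a))// (le_lt_trans (ler_norm _)).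
Qed.

Lemma controlD w1 w2 : control w1 -> control w2 -> control (fun a => w1 a + w2 a).
Proof.
move=> [c1 p1 d1 s1] [c2 p2 d2 s2]; split.
- by move=> a; apply: cvgD; [exact: c1|exact: c2].
- by move=> a; rewrite addr_ge0.
- by move=> a ha; rewrite d1// d2// addr0.
- by move=> a b c h; rewrite addrACA lerD// ?(s1 _ _ _ h)// (s2 _ _ _ h).
Qed.

Lemma level_close_control w w' theta theta' X Y : control w -> control w' ->
  (forall a, w a <= w' a) -> 0 <= theta' -> theta' <= theta ->
  level_close theta w X Y -> level_close theta' w' X Y.
Proof.
move=> hw hw' ww t0 tt h i i0; have [C C0 hC] := h i i0.
apply: (control_weaken hJ hw' t0 tt); exists C => // a.
rewrite (le_trans (hC a))// ler_wpM2l//.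
by apply: ge0_ler_powR; rewrite ?nnegrE ?(control_ge0 hw) ?(control_ge0 hw')// (le_trans t0).
Qed.

(** Where two candidates agree on all lower levels, their difference is
    additive; being of order larger than one for the sum of the two controls, it
    vanishes. *)
Lemma sewing_unique w1 w2 th1 th2 Y1 Y2 Z : control w1 -> control w2 ->
  1 < th1 -> 1 < th2 -> unital Y1 -> unital Y2 ->
  (forall i, chen_at Y1 i) -> (forall i, chen_at Y2 i) ->
  level_close th1 w1 Y1 Z -> level_close th2 w2 Y2 Z -> Y1 = Y2.
Proof.
move=> hw1 hw2 th11 th21 Y11 Y21 hY1 hY2 c1 c2.
pose w a := w1 a + w2 a; pose th := Num.min th1 th2.
have hw : control w by exact: controlD.
have th_1 : 1 < th by rewrite lt_min th11.
have th_0 : 0 <= th by rewrite ltW// (lt_trans _ th_1).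
have c12 : level_close th w Y1 Y2.
  apply: (level_close_trans (Y := Z)).
    apply: (level_close_control hw1 hw _ th_0 _ c1); last by rewrite ge_min lexx.
    by move=> a; rewrite lerDl (control_ge0 hw2).
  apply: level_close_sym; apply: (level_close_control hw2 hw _ th_0 _ c2);
    last by rewrite ge_min lexx orbT.
  by move=> a; rewrite lerDr (control_ge0 hw1).
suff main n (i : 'I_k.+1) : (i < n)%N -> forall a, Y1 a i = Y2 a i.
  by apply/funext => a; apply/functional_extensionality_dep => i; exact: (main i.+1).
elim: n i => // n IH i; rewrite ltnS => ni a.
have [i0|i0] := posnP i.
  by have -> : i = ord0 by [apply/val_inj]; rewrite Y11 Y21.
have [C C0 hC] := c12 i i0.
have add c d e : splits c d e -> `|Y1 c i - Y2 c i| <=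
    `|Y1 d i - Y2 d i| + `|Y1 e i - Y2 e i| + 0 * w c `^ th.
  move=> h; rewrite mul0r addr0 -(hY1 i _ _ _ h) -(hY2 i _ _ _ h) !tmul_cross//.
  have -> : cross (Y1 d) (Y1 e) i = cross (Y2 d) (Y2 e) i.
    by apply: eq_cross => j /andP[_ ji]; apply: IH; exact: leq_trans ji ni.
  by rewrite [X in `|_ - X|]addrC addrKA opprD addrACA ler_normD.
have := subadditive_bound hJ hw th_1 th_1 (lexx 0) add hC a.
by rewrite mul0r mul0r normr_le0 subr_eq0 => /eqP.
Qed.

Lemma tmul_ord0 (a b : truncTensor E k) : a ord0 = tone E ord0 ->
  b ord0 = tone E ord0 -> tmul a b ord0 = tone E ord0.
Proof.
move=> a0 b0; rewrite tmulE big_ord_recl a0 big_ord_recl b0 tone0 gmul1l.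
rewrite big1 ?addr0 => [|n _]; last by rewrite gmul_neq.
by rewrite big1 ?addr0// => m _; rewrite big1// => n _; rewrite gmul_neq.
Qed.

Lemma tmul_subl (a a' c : truncTensor E k) (i : 'I_k.+1) : (0 < i)%N ->
  a ord0 = tone E ord0 -> a' ord0 = tone E ord0 -> c ord0 = tone E ord0 ->
  (forall j : 'I_k.+1, (0 < j < i)%N -> a j = a' j) ->
  tmul a c i - a i = tmul a' c i - a' i.
Proof.
move=> i0 a0 a0' c0 aa; rewrite !tmul_cross// (eq_cross aa (fun _ _ => erefl)).
by rewrite -(addrA (a i)) -(addrA (a' i)) [a i + _]addrC [a' i + _]addrC !addrK.
Qed.

Lemma tmul_subr (a b b' : truncTensor E k) (i : 'I_k.+1) : (0 < i)%N ->
  a ord0 = tone E ord0 -> b ord0 = tone E ord0 -> b' ord0 = tone E ord0 ->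
  (forall j : 'I_k.+1, (0 < j < i)%N -> b j = b' j) ->
  tmul a b i - b i = tmul a b' i - b' i.
Proof.
move=> i0 a0 b0 b0' bb; rewrite !tmul_cross// (eq_cross (fun _ _ => erefl) bb).
by rewrite (addrAC (a i) (b i)) (addrAC (a i) (b' i)) !addrK.
Qed.

Section Existence.
Context (w : simplex S T -> R) (hw : control w) (p theta : R) (Z : tpath).
Hypothesis p1 : 1 <= p.
Hypothesis theta1 : 1 < theta.
Hypothesis Z1 : unital Z.
Hypothesis Zp : pvar p w Z.
Hypothesis Zam : almost_mult theta w Z.

Let theta0 : 0 < theta. Proof. exact: lt_trans theta1. Qed.
Let p0 : 0 < p. Proof. exact: lt_le_trans p1. Qed.
Let Zbounded (i : 'I_k.+1) : (0 < i)%N -> ordO w 0 (fun a => `|Z a i|).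
Proof. by move=> i0; apply: (pvar_weaken hJ hw p0 Zp i0) => //; rewrite divr_ge0// ltW. Qed.

(** If Chen's relation holds below level [i], its defect on level [i] is a
    cocycle by associativity, so that additive sewing corrects it. *)
Lemma sew_level Y (i : 'I_k.+1) : (0 < i)%N -> unital Y -> level_close theta w Y Z ->
  (forall j : 'I_k.+1, (j < i)%N -> chen_at Y j) ->
  exists Y', [/\ unital Y', level_close theta w Y' Z &
    forall j : 'I_k.+1, (j <= i)%N -> chen_at Y' j].
Proof.
move=> i0 Y1 cYZ hY.
pose d s u t := tmul (Y (pt s u)) (Y (pt u t)) i - Y (pt s t) i.
have Yam : almost_mult theta w Y.
  exact: (almost_mult_close hJ hw theta0 Z1 Y1 Zbounded cYZ Zam).
have [K K0 hK] := Yam i i0.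
have d_bound s u t : S <= s -> s <= u -> u <= t -> t <= T ->
    `|d s u t| <= K * w (pt s t) `^ theta.
  by move=> Ss su ut tT; exact: (hK (Triple (splits_seg hJ Ss su ut tT))).
have d_cocycle s u t v : S <= s -> s <= u -> u <= t -> t <= v -> v <= T ->
    d s t v + d s u t = d s u v + d u t v.
  move=> Ss su ut tv vT.
  have [st uv Su] := And3 (le_trans su ut) (le_trans ut tv) (le_trans Ss su).
  have [tT sv] := (le_trans tv vT, le_trans st tv).
  have re (x q y z : E i) : (x - q) + (y - z) = (x - z) + y - q.
    by rewrite addrC addrA [y - z + x]addrAC -[y + x - z]addrA [y + _]addrC.
  (* Both sides are the difference on level [i] between [Y s u * Y u t * Y t v]
     and [Y s v]. *)
  have hl := hY _ _ _ _ _ (splits_seg hJ Ss su ut tT).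
  have hr := hY _ _ _ _ _ (splits_seg hJ Su ut tv vT).
  rewrite /d !re; congr (_ - _).
  rewrite (@tmul_subl _ (tmul (Y (pt s u)) (Y (pt u t)))) ?subrK ?tmul_ord0//; last first.
    by move=> j /andP[_ ji]; rewrite hl.
  rewrite (@tmul_subr _ _ (tmul (Y (pt u t)) (Y (pt t v)))) ?subrK ?tmul_ord0 ?tmulA//.
  by move=> j /andP[_ ji]; rewrite hr.
have [F [[B B0 FB] FD]] := additive_sewing hw K0 theta1 d_cocycle d_bound.
pose Y' a : truncTensor E k := dfwith (Y a) i (Y a i + F (set_val a).1 (set_val a).2).
have Y'i a : Y' a i = Y a i + F (set_val a).1 (set_val a).2 by rewrite /Y' dfwithin.
have Y'j a (j : 'I_k.+1) : j != i -> Y' a j = Y a j.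
  by move=> ji; rewrite /Y' dfwithout// eq_sym.
have Y'lt a (j : 'I_k.+1) : (j < i)%N -> Y' a j = Y a j.
  by move=> ji; apply: Y'j; apply/eqP => e; rewrite e ltnn in ji.
have Y'1 : unital Y' by move=> a; rewrite Y'lt.
exists Y'; split => //.
  move=> j j0; have [->{j j0}|ji] := eqVneq j i; last first.
    by apply: ordO_le (cYZ j j0) => a; rewrite Y'j.
  apply: (@ordO_le _ _ _ _ _
    (fun a => `|Y a i - Z a i| + `|F (set_val a).1 (set_val a).2|)).
    by move=> a; rewrite Y'i addrAC ler_normD.
  apply: ordOD; first exact: cYZ.
  exists B => // a; have [s [t [Ss st tT ->]]] := simplex_seg hJ a.
  by rewrite seg_val//; exact: FB.
move=> j ji a b c abc; have [j0|j0] := posnP j.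
  have -> : j = ord0 by apply/val_inj.
  by rewrite tmul_ord0.
rewrite tmul_cross//.
have -> : cross (Y' a) (Y' b) j = cross (Y a) (Y b) j.
  by apply: eq_cross => l /andP[_ lj]; apply: Y'lt; exact: leq_trans lj ji.
have [ji'|ij] := eqVneq j i; last first.
  have jli : (j < i)%N by rewrite ltn_neqAle ji andbT; apply: contra ij => /eqP/val_inj->.
  by rewrite !Y'lt// -tmul_cross// (hY j jli _ _ _ abc).
subst j; rewrite !Y'i.
have [s [u [t [[Ss su ut tT] [-> -> ->]]]]] := splits_segP hJ abc.
have [st uT Su] := And3 (le_trans su ut) (le_trans ut tT) (le_trans Ss su).
rewrite !seg_val//= (FD s u t)//.
rewrite [in LHS]addrACA (addrAC (Y _ i + _)) -(tmul_cross (Y1 _) (Y1 _) i0).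
by rewrite /d [RHS]addrC -addrA subrK addrC.
Qed.

Lemma sew_levels n : exists Y, [/\ unital Y, level_close theta w Y Z &
  forall j : 'I_k.+1, (j < n.+1)%N -> chen_at Y j].
Proof.
elim: n => [|n [Y [Y1 cY hY]]].
  exists Z; split => // [i i0|j j0 a b c abc].
    by apply: ordO_cst => a; rewrite subrr normr0.
  have -> : j = ord0 by apply/val_inj; move: j0; rewrite ltnS leqn0 => /eqP.
  by rewrite tmul_ord0.
have [nk|kn] := ltnP n.+1 k.+1; last first.
  by exists Y; split => // j _; apply: hY; exact: leq_trans (ltn_ord j) kn.
exact: (@sew_level Y (Ordinal nk)).
Qed.

(** Closeness to [Z] bounds level [i] by [w^(i/p)] as long as [i/p <= theta];
    beyond, Chen's relation and the lower levels do. *)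
Lemma sewn_pvar Y : unital Y -> level_close theta w Y Z -> (forall i, chen_at Y i) ->
  pvar p w Y.
Proof.
move=> Y1 cY hY; suff main n (i : 'I_k.+1) : (i < n)%N -> (0 < i)%N ->
    ordO w (i%:R / p) (fun a => `|Y a i|) by move=> i; exact: (main i.+1).
elim: n i => // n IH i; rewrite ltnS => ni i0.
have ip0 : 0 <= i%:R / p by rewrite divr_ge0// ltW.
have YZ r : ordO w r (fun a => `|Y a i - Z a i|) -> ordO w r (fun a => `|Z a i|) ->
    ordO w r (fun a => `|Y a i|).
  move=> h h'; apply: ordO_le (ordOD h h') => a.
  by rewrite -{1}(subrK (Z a i) (Y a i)) ler_normD.
have [it|it] := leP (i%:R / p) theta.
  by apply: YZ; [exact: (control_weaken hJ hw ip0 it (cY i i0))|exact: Zp].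
have [A A0 hA] : ordO w theta (fun a => `|Y a i|).
  apply: YZ; first exact: cY.
  exact: (control_weaken hJ hw (ltW theta0) (ltW it) (Zp i0)).
have [C C0 hC] : ordO (w \o @tc R S T) (i%:R / p)
    (fun z => `|cross (Y (ta z)) (Y (tb z)) i|).
  have pV : 0 < p^-1 by rewrite invr_gt0.
  apply: ordO_cross_graded => // m /andP[m0 mi].
    apply: (ordO_restrict (f := fun a => `|Y a m|) hw _ (ta_le hw)).
      by rewrite divr_ge0// ltW.
    by apply: IH => //; exact: leq_trans mi ni.
  apply: (ordO_restrict (f := fun a => `|Y a m|) hw _ (tb_le hw)).
    by rewrite divr_ge0// ltW.
  by apply: IH => //; exact: leq_trans mi ni.
have it1 := lt_trans theta1 it.
exists (C / (1 - 2 `^ (1 - i%:R / p))).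
  by rewrite divr_ge0// subr_ge0 ltW// powR2_lt1.
apply: (subadditive_bound hJ hw theta1 it1 C0 _ hA) => c d e h.
rewrite -(hY i _ _ _ h) tmul_cross// (le_trans (ler_normD _ _))// lerD ?ler_normD//.
exact: (hC (Triple h)).
Qed.

Lemma rough_sewing : exists Y, Omega p w Y /\ level_close theta w Y Z.
Proof.
have [Y [Y1 cY hY]] := sew_levels k.
have hY' i : chen_at Y i by exact: hY (ltn_ord i).
have pY := sewn_pvar Y1 cY hY'.
exists Y; split => //; apply/OmegaP => //; split => //; split => //.
- have ip : 0 < 1 / p by rewrite divr_gt0.
  apply: (chen_continuous hw ip) => // i i0.
  by apply: (pvar_weaken hJ hw p0 pY) => //; exact: ltW.
- by move=> a b c h; apply/functional_extensionality_dep => i; exact: hY'.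
Qed.

End Existence.

End Sewing.

(** * Sum and product with a small perturbation *)

Section Boxplus.
Context {R : realType} {V : completeNormedModType R} (E : tensorPowers V).
Context {S T : R} (hJ : S <= T) (k : nat).
Local Notation tpath := (simplex S T -> truncTensor E k).
Implicit Types (X Y Z H : tpath) (p theta phi : R) (w : simplex S T -> R).

Lemma mult_functional_chen_at X i : mult_functional X -> chen_at X i.
Proof. by move=> hX a b c /(mult_chen hX)->. Qed.

(** By uniqueness, any control and any exponents may be used to compute it. *)
Lemma sewing_eq p theta w Y Z : control w -> 1 <= p -> 1 < theta ->
  Omega_am p theta w Z -> Omega p w Y -> level_close theta w Y Z ->
  sewing Z = Y.
Proof.
move=> hw p1 th1 hZ hY cYZ; apply: xget_unique.
  exists p, theta, w; split => //; split; first by exists w.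
  exact/level_closeP.
move=> Y' [p' [th' [w' [_ th'1 hw' _ [[w2 _ [mY' _]] /level_closeP cY'Z]]]]].
have [mY _] := hY.
apply: (sewing_unique hJ hw' hw th'1 th1 _ _ _ _ cY'Z cYZ).
- exact: mult_level0 mY'.
- exact: mult_level0 mY.
- by move=> i; exact: mult_functional_chen_at.
- by move=> i; exact: mult_functional_chen_at.
Qed.

Lemma path_oplusE X H a (i : 'I_k.+1) : (0 < i)%N ->
  path_oplus X H a i = X a i + H a i.
Proof. by rewrite /path_oplus /toplus; case: eqP => // ->. Qed.

Section Pair.
Context (w : simplex S T -> R) (hw : control w) (p phi : R) (X H : tpath).
Hypothesis p1 : 1 <= p.
Hypothesis phi_gt : 1 - 1 / p < phi.
Hypothesis mX : mult_functional X.
Hypothesis mH : mult_functional H.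
Hypothesis pX : pvar p w X.
Hypothesis pH : pvar p w H.
Hypothesis phiH : forall i : 'I_k.+1, (0 < i)%N -> ordO w phi (fun a => `|H a i|).

Let p0 : 0 < p. Proof. exact: lt_le_trans p1. Qed.
Let pV0 : 0 <= 1 / p. Proof. by rewrite divr_ge0// ltW. Qed.
Let phi0 : 0 <= phi.
Proof. by rewrite ltW// (le_lt_trans _ phi_gt)// subr_ge0 ler_pdivrMr// mul1r. Qed.
Let theta0 : 0 < phi + 1 / p.
Proof. by rewrite ltr_wpDl// divr_gt0. Qed.
Let X1 : unital X. Proof. exact: mult_level0. Qed.
Let H1 : unital H. Proof. exact: mult_level0. Qed.
Let X1p (i : 'I_k.+1) : (0 < i)%N -> ordO w (1 / p) (fun a => `|X a i|).
Proof. by move=> i0; exact: (pvar_weaken hJ hw p0 pX). Qed.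

Lemma path_oplus_unital : unital (path_oplus X H).
Proof. by move=> a; rewrite /path_oplus /toplus eqxx. Qed.

Lemma path_tensor_unital : unital (path_tensor X H).
Proof. by move=> a; rewrite /path_tensor tmul_ord0. Qed.

Lemma path_oplus_pvar : pvar p w (path_oplus X H).
Proof.
move=> i i0; apply: ordO_le (ordOD (pX i0) (pH i0)) => a.
by rewrite path_oplusE// ler_normD.
Qed.

(** Chen's relations for [X] and [H] cancel, and leave products of one factor
    [X] by one factor [H]. *)
Lemma path_oplus_almost_mult : almost_mult (phi + 1 / p) w (path_oplus X H).
Proof.
move=> i i0.
have re (xa xb ha hb xx xh hx hh : E i) :
    xa + ha + (xb + hb) + (xx + xh + (hx + hh)) -
    (xa + xb + xx + (ha + hb + hh)) = hx + xh.
  rewrite (addrACA xa) [hx + hh]addrC (addrACA xx) [X in X - _]addrA (addrACA (xa + xb)).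
  by rewrite [LHS]addrC addKr addrC.
apply: (@ordO_le _ _ _ _ _ (fun z => `|cross (H (ta z)) (X (tb z)) i| +
    `|cross (X (ta z)) (H (tb z)) i|)) => [z|].
  have h := tsplits z.
  rewrite tmul_cross ?path_oplus_unital// !path_oplusE//.
  have -> : cross (path_oplus X H (ta z)) (path_oplus X H (tb z)) i =
      cross (fun j => X (ta z) j + H (ta z) j) (fun j => X (tb z) j + H (tb z) j) i.
    by apply: eq_cross => j /andP[j0 _]; exact: path_oplusE.
  rewrite crossDl !crossDr -(mult_chen mX h) -(mult_chen mH h) !tmul_cross//.
  rewrite re.
  exact: ler_normD.
apply: ordOD.
  apply: ordO_cross => // m m0.
    by apply: (ordO_restrict (f := fun a => `|H a m|) hw _ (ta_le hw)) => //; exact: phiH.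
  by apply: (ordO_restrict (f := fun a => `|X a m|) hw _ (tb_le hw)) => //; exact: X1p.
rewrite addrC; apply: ordO_cross; rewrite 1?addrC// => m m0.
  by apply: (ordO_restrict (f := fun a => `|X a m|) hw _ (ta_le hw)) => //; exact: X1p.
by apply: (ordO_restrict (f := fun a => `|H a m|) hw _ (tb_le hw)) => //; exact: phiH.
Qed.

(** The difference is a cross term: products of one factor [X] by one factor
    [H], as above. *)
Lemma path_tensor_close : level_close (phi + 1 / p) w (path_tensor X H) (path_oplus X H).
Proof.
move=> i i0; apply: (@ordO_le _ _ _ _ _ (fun a => `|cross (X a) (H a) i|)).
  by move=> a; rewrite path_oplusE// /path_tensor tmul_cross// addrC addKr.
by rewrite addrC; apply: ordO_cross; rewrite 1?addrC.
Qed.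

Lemma path_tensor_pvar : pvar p w (path_tensor X H).
Proof.
move=> i i0; apply: (@ordO_le _ _ _ _ _
    (fun a => `|X a i| + `|H a i| + `|cross (X a) (H a) i|)).
  move=> a; rewrite /path_tensor tmul_cross// (le_trans (ler_normD _ _))//.
  by rewrite lerD2r ler_normD.
apply: ordOD; first by apply: ordOD; [exact: pX|exact: pH].
by apply: ordO_cross_graded => [|m /andP[m0 _]|m /andP[m0 _]];
  [rewrite invr_gt0|exact: pX|exact: pH].
Qed.

Lemma path_tensor_almost_mult : almost_mult (phi + 1 / p) w (path_tensor X H).
Proof.
apply: (almost_mult_close hJ hw theta0 path_oplus_unital path_tensor_unital _
  path_tensor_close path_oplus_almost_mult) => i i0.
exact: (pvar_weaken hJ hw p0 path_oplus_pvar).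
Qed.

End Pair.
End Boxplus.

Theorem theorem2p44 (R : realType) (V : completeNormedModType R)
    (E : tensorPowers V) (S T : R) (hJ : S <= T)
    (p : R) (hp : 1 <= p) (k : nat) (hk : (1 <= k)%N)
    (phi : R) (hphi : 1 - 1 / p < phi /\ phi <= 1)
    (w : simplex S T -> R) (hw : control w)
    (H : simplex S T -> truncTensor E k) (hH : Hspace p phi w H)
    (X : simplex S T -> truncTensor E k) (hX : Omega p w X) :
  [/\ Omega_am p (phi + 1 / p) w (path_oplus X H),
      Omega_am p (phi + 1 / p) w (path_tensor X H),
      Omega p w (path_boxplus X H)
    & sewing (path_tensor X H) = path_boxplus X H].
Proof.
have [phi_gt _] := hphi.
have p0 : 0 < p by exact: lt_le_trans hp.
have theta1 : 1 < phi + 1 / p by rewrite -ltrBlDr.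
have /(OmegaP _ _ p0)[mX pX] := hX.
have [/(OmegaP _ _ p0)[mH pH] [K K0 hK]] := hH.
have phiH (i : 'I_k.+1) : (0 < i)%N -> ordO w phi (fun a => `|H a i|).
  by move=> i0; exists K => // a; exact: hK.
have oplus1 := path_oplus_unital X H.
have oplusP := path_oplus_pvar pX pH.
have oplusM := path_oplus_almost_mult hJ hw hp phi_gt mX mH pX phiH.
have oplus_am : Omega_am p (phi + 1 / p) w (path_oplus X H) by exact/Omega_amP.
have tensor_am : Omega_am p (phi + 1 / p) w (path_tensor X H).
  apply/Omega_amP => //; split.
  - exact: path_tensor_unital.
  - exact: path_tensor_pvar.
  - exact: (path_tensor_almost_mult hJ).
have [Y [oY cY]] := rough_sewing hJ hw hp theta1 oplus1 oplusP oplusM.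
have boxE : path_boxplus X H = Y by exact: (sewing_eq hJ hw hp theta1 oplus_am oY cY).
split => //; first by rewrite boxE.
rewrite boxE; apply: (sewing_eq hJ hw hp theta1 tensor_am oY).
apply: level_close_trans cY _; apply: level_close_sym.
exact: (path_tensor_close hJ).
Qed.
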